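(* Let $n_1\ge 2$, $n_2\ge 1$ and let $Z$ be the hypersurface in $\mathbb{K}^{n_1+n_2}$ (with coordinates $T_{11},\dots,T_{1n_1},T_{21},\dots,T_{2n_2}$) given by $$T_{11}T_{12}^{l_{12}}\cdots T_{1n_1}^{l_{1n_1}}=T_{21}^{l_{21}}\cdots T_{2n_2}^{l_{2n_2}}+1,$$ where all $l_{ij}$ are positive integers. Assume that if $n_2=1$, then $l_{21}\ge 2$. Let $X=Z\times\mathbb{K}$. Then there exist infinitely many pairwise non-conjugate maximal tori of dimension $n_1+n_2-1=\dim X-1$ in $\mathrm{Aut}(X)$.
   Context: $\mathbb{K}$ is an algebraically closed field of characteristic zero. $\mathrm{Aut}(X)$ is the group of regular automorphisms of $X$. A torus in $\mathrm{Aut}(X)$ is an algebraic subgroup isomorphic to $(\mathbb{K}^\times)^d$; it is maximal if it is not properly contained in another torus in $\mathrm{Aut}(X)$. Conjugacy is in $\mathrm{Aut}(X)$. *)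

(* Defs.v *)
From HB Require Import structures.
From mathcomp Require Import all_boot all_order all_algebra.
From mathcomp Require Import mpoly.
Set Implicit Arguments.
Unset Strict Implicit.
Unset Printing Implicit Defensive.
Import GRing.Theory.
Local Open Scope ring_scope.

(* A closed subset of affine space, presented by equations.  Only its set of
   K-points matters below: regular functions and maps are restrictions of
   polynomials to the points, so over an algebraically closed field this is the
   affine variety (reduced structure) cut out by the equations. *)
Record affset (K : fieldType) := AffSet {
  adim : nat;
  aeqs : seq {mpoly K[adim]}
}.

Definition on_affset (K : fieldType) (X : affset K)
    (v : {ffun 'I_(adim X) -> K}) : bool :=
  all (fun p => p.@[v] == 0) (aeqs X).
Arguments on_affset {K} X v.

Record point (K : fieldType) (X : affset K) := Point {
  coord :> {ffun 'I_(adim X) -> K};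
  coordP : on_affset X coord
}.
Arguments Point {K X} coord coordP.

HB.instance Definition _ (K : fieldType) (X : affset K) :=
  [isSub for @coord K X].
HB.instance Definition _ (K : fieldType) (X : affset K) :=
  [Equality of point X by <:].

Definition regular_fun (K : fieldType) (X : affset K) (f : point X -> K) : Prop :=
  exists p : {mpoly K[adim X]}, forall x, f x = p.@[x].

Definition regular_map (K : fieldType) (X Y : affset K)
    (f : point X -> point Y) : Prop :=
  forall i : 'I_(adim Y), regular_fun (fun x => f x i).

Section Product.
Variables (K : fieldType) (X Y : affset K).

Definition affprod : affset K :=
  @AffSet K (adim X + adim Y)
    ([seq p \mPo [tuple 'X_(lshift (adim Y) i) | i < adim X] | p <- aeqs X] ++
     [seq p \mPo [tuple 'X_(rshift (adim X) i) | i < adim Y] | p <- aeqs Y]).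

Lemma affprod1P (z : point affprod) :
  on_affset X [ffun i => z (lshift (adim Y) i)].
Proof.
apply/allP => p pX; have /allP/= zP := coordP z.
have /zP : p \mPo [tuple 'X_(lshift (adim Y) i) | i < adim X] \in aeqs affprod.
  by rewrite mem_cat (map_f (fun p => p \mPo _) pX).
rewrite comp_mpoly_meval => /eqP <-; apply/eqP/meval_eq => i.
by rewrite tnth_mktuple mevalXU ffunE.
Qed.

Lemma affprod2P (z : point affprod) :
  on_affset Y [ffun i => z (rshift (adim X) i)].
Proof.
apply/allP => p pY; have /allP/= zP := coordP z.
have /zP : p \mPo [tuple 'X_(rshift (adim X) i) | i < adim Y] \in aeqs affprod.
  by rewrite mem_cat (map_f (fun p => p \mPo _) pY) orbT.
rewrite comp_mpoly_meval => /eqP <-; apply/eqP/meval_eq => i.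
by rewrite tnth_mktuple mevalXU ffunE.
Qed.

Definition proj1p (z : point affprod) : point X := Point _ (affprod1P z).
Definition proj2p (z : point affprod) : point Y := Point _ (affprod2P z).

End Product.

Definition affine_line (K : fieldType) : affset K := @AffSet K 1 [::].

Definition alg_indep (K : fieldType) (X : affset K) (r : nat)
    (F : 'I_r -> point X -> K) : Prop :=
  forall P : {mpoly K[r]}, (forall x, P.@[fun i => F i x] = 0) -> P = 0.

(* The maximal number of algebraically independent regular functions
   on X is d (for irreducible X, the transcendence degree of K(X) over K). *)
Definition has_dim (K : fieldType) (X : affset K) (d : nat) : Prop :=
  (exists F : 'I_d -> point X -> K,
     (forall i, regular_fun (F i)) /\ alg_indep F) /\
  (forall r (F : 'I_r -> point X -> K),
     (forall i, regular_fun (F i)) -> alg_indep F -> (r <= d)%N).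

(* Two elements of Aut(X) are considered equal when their underlying maps are
   extensionally equal; subsets of Aut(X) used below are closed under =1. *)
Record aut (K : fieldType) (X : affset K) := Aut {
  aut_fun :> point X -> point X;
  aut_ifun : point X -> point X;
  aut_funK : cancel aut_fun aut_ifun;
  aut_ifunK : cancel aut_ifun aut_fun;
  aut_regular : regular_map aut_fun;
  aut_iregular : regular_map aut_ifun
}.

Record algGroup (K : fieldType) := AlgGroup {
  ag_set :> affset K;
  ag_one : point ag_set;
  ag_mul : point ag_set -> point ag_set -> point ag_set;
  ag_inv : point ag_set -> point ag_set;
  ag_mulA : associative ag_mul;
  ag_mul1 : left_id ag_one ag_mul;
  ag_mulV : left_inverse ag_one ag_inv ag_mul;
  ag_mul_regular : regular_map
    (fun z : point (affprod ag_set ag_set) => ag_mul (proj1p z) (proj2p z));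
  ag_inv_regular : regular_map ag_inv
}.

Definition ag_isom (K : fieldType) (G H : algGroup K) : Prop :=
  exists (phi : point G -> point H) (psi : point H -> point G),
    [/\ cancel phi psi, cancel psi phi, regular_map phi, regular_map psi
      & forall g h, phi (ag_mul g h) = ag_mul (phi g) (phi h)].

(* The torus of invertible d-tuples, realized as {(t, s) in K^d x K^d | t_i s_i = 1 for all i} *)
Section StandardTorus.
Variables (K : fieldType) (d : nat).

Definition Gm_set : affset K :=
  @AffSet K (d + d) [seq 'X_(lshift d i) * 'X_(rshift d i) - 1 | i : 'I_d].

Lemma Gm_setP (v : {ffun 'I_(d + d) -> K}) :
  reflect (forall i : 'I_d, v (lshift d i) * v (rshift d i) = 1)
          (on_affset Gm_set v).
Proof.
apply: (iffP allP) => [vP i | vP p /= /mapP[i _ ->]].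
  have /vP : 'X_(lshift d i) * 'X_(rshift d i) - 1 \in aeqs Gm_set.
    by apply/mapP; exists i; rewrite ?mem_enum.
  by rewrite mevalB mevalM !mevalXU meval1 subr_eq0 => /eqP.
by rewrite mevalB mevalM !mevalXU meval1 vP subrr.
Qed.

Lemma Gm_oneP : on_affset Gm_set [ffun=> 1].
Proof. by apply/Gm_setP => i; rewrite !ffunE mulr1. Qed.
Definition Gm_one : point Gm_set := Point _ Gm_oneP.

Lemma Gm_mulP (g h : point Gm_set) : on_affset Gm_set [ffun i => g i * h i].
Proof.
apply/Gm_setP => i; rewrite !ffunE mulrACA.
by have /Gm_setP-> := coordP g; have /Gm_setP-> := coordP h; rewrite mulr1.
Qed.
Definition Gm_mul (g h : point Gm_set) : point Gm_set := Point _ (Gm_mulP g h).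

Definition swap_half (i : 'I_(d + d)) : 'I_(d + d) :=
  match split i with inl j => rshift d j | inr j => lshift d j end.

Lemma swap_halfl j : swap_half (lshift d j) = rshift d j.
Proof. by rewrite /swap_half -[lshift _ _]/(unsplit (inl j)) unsplitK. Qed.
Lemma swap_halfr j : swap_half (rshift d j) = lshift d j.
Proof. by rewrite /swap_half -[rshift _ _]/(unsplit (inr j)) unsplitK. Qed.

Lemma Gm_invP (g : point Gm_set) : on_affset Gm_set [ffun i => g (swap_half i)].
Proof.
apply/Gm_setP => i; rewrite !ffunE swap_halfl swap_halfr mulrC.
by have /Gm_setP-> := coordP g.
Qed.
Definition Gm_inv (g : point Gm_set) : point Gm_set := Point _ (Gm_invP g).

Lemma Gm_mulA : associative Gm_mul.
Proof. by move=> f g h; apply/val_inj/ffunP => i; rewrite !ffunE mulrA. Qed.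
Lemma Gm_mul1 : left_id Gm_one Gm_mul.
Proof. by move=> g; apply/val_inj/ffunP => i; rewrite !ffunE mul1r. Qed.
Lemma Gm_mulV : left_inverse Gm_one Gm_inv Gm_mul.
Proof.
move=> g; apply/val_inj/ffunP => i; rewrite !ffunE.
rewrite -(splitK i); case: (split i) => j /=.
  by rewrite swap_halfl mulrC; have /Gm_setP-> := coordP g.
by rewrite swap_halfr; have /Gm_setP-> := coordP g.
Qed.

Lemma Gm_mul_regular : regular_map
  (fun z : point (affprod Gm_set Gm_set) => Gm_mul (proj1p z) (proj2p z)).
Proof.
move=> i; exists ('X_(lshift (d + d) i) * 'X_(rshift (d + d) i)) => z.
by rewrite mevalM !mevalXU !ffunE.
Qed.
Lemma Gm_inv_regular : regular_map Gm_inv.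
Proof. by move=> i; exists 'X_(swap_half i) => z; rewrite mevalXU !ffunE. Qed.

Definition Gm : algGroup K :=
  AlgGroup Gm_mulA Gm_mul1 Gm_mulV Gm_mul_regular Gm_inv_regular.

End StandardTorus.
Arguments Gm K d : clear implicits.

Section Tori.
Variables (K : fieldType) (X : affset K).

(* T is the algebraic subgroup of Aut(X) whose algebraic group structure is
   transported from G along the injective homomorphism rho; algebraicity means
   that the action G x X -> X is a morphism. *)
Definition alg_subgroup (G : algGroup K) (rho : point G -> aut X)
    (T : aut X -> Prop) : Prop :=
  [/\ forall g h, rho (ag_mul g h) =1 rho g \o rho h,
      forall g h, rho g =1 rho h -> g = h,
      regular_map (fun z : point (affprod G X) => rho (proj1p z) (proj2p z))
    & forall f, T f <-> exists g, f =1 rho g].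

Definition is_torus (d : nat) (T : aut X -> Prop) : Prop :=
  exists (G : algGroup K) (rho : point G -> aut X),
    alg_subgroup rho T /\ ag_isom G (Gm K d).

Definition is_maximal_torus (d : nat) (T : aut X -> Prop) : Prop :=
  is_torus d T /\
  forall (d' : nat) (T' : aut X -> Prop), is_torus d' T' ->
    (forall f, T f -> T' f) -> (forall f, T' f -> T f).

Definition conjugate (T T' : aut X -> Prop) : Prop :=
  exists g : aut X, forall f' : aut X,
    T' f' <-> exists2 f : aut X, T f & f' =1 g \o f \o aut_ifun g.

End Tori.

(* The coordinates T_11, ..., T_1n1 come first (lshift), T_21, ..., T_2n2 next
   (rshift). *)
Definition trinomial_hypersurface (K : fieldType) (n1 n2 : nat)
    (l1 : 'I_n1 -> nat) (l2 : 'I_n2 -> nat) : affset K :=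
  @AffSet K (n1 + n2)
    [:: \prod_(j < n1) 'X_(lshift n2 j) ^+ l1 j
        - (\prod_(j < n2) 'X_(rshift n1 j) ^+ l2 j + 1)].
Arguments trinomial_hypersurface K {n1 n2} l1 l2.

(* Main.v *)
Require Import Defs.
From HB Require Import structures.
From mathcomp Require Import all_boot all_order all_algebra.
From mathcomp Require Import mpoly.
From mathcomp Require Import ring zify.
Set Implicit Arguments.
Unset Strict Implicit.
Unset Printing Implicit Defensive.
Import Order.TTheory GRing.Theory Num.Theory.
Local Open Scope ring_scope.

(** Write a point of X as (x, y, z, w), where x = T_11, y consists of the other
    T_1j, z of the T_2j, and w is the coordinate of the line. The equation is
    x y^a = z^b + 1.

    The exponents a of y do not matter up to isomorphism once the factor K is
    there: this is the Danielewski trick, [danielewski]. Hence for every large N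
    the variety X is also isomorphic to the product with K of the hypersurface
    x (y_1 ... y_k)^N = z^b + 1, and the torus of diagonal automorphisms of
    that model gives a torus T_N in Aut(X). The equations of the diagonal
    group are s^b = 1 on the factors of z, with the factors of y and w free and
    that of x determined; if d is the gcd of b and b = d beta, its identity
    component is cut out by s^beta = 1 and is a torus of dimension dim X - 1
    ([torusP]).

    T_N is maximal ([torus_maximal]) because a larger torus centralizes it.
    The pull-back of a coordinate y_j, z_j or w along an automorphism commuting
    with T_N is a semi-invariant of the same weight, hence that coordinate times
    a polynomial in the invariant u = z^beta ([semi_invariant]). Playing the
    automorphism against its inverse makes that polynomial constant
    ([weight_centralizer]). So the centralizer is diagonal; the only case in
    which this argument leaves something to prove is n_2 = 1, where z is itself
    invariant and is mapped to an affine function of z that permutes the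
    roots of z^b = -1, with b >= 2, hence is linear. Finally every element of a
    torus is a d-th power, and d-th powers in the diagonal group satisfy
    s^beta = 1.

    T_N and T_N' are not conjugate because their finite stabilizers differ: a
    point whose only vanishing coordinate is one y_j has a cyclic stabilizer
    of order N in T_N, while the other finite stabilizers are trivial or have
    order dividing some b_j ([torus_stabilizer_dvd], [torus_stabilizer_ndvd]).
    A sequence of values of N that grows fast for divisibility then gives
    infinitely many conjugacy classes.

    Most identities between regular functions are only checked where y, z and w
    have no vanishing coordinate; [density] says that this suffices. It
    also gives the dimension of X: there y, z, w determine x, and a count of
    monomials bounds the number of algebraically independent functions
    ([indep_bound]). *)

(** * Polynomials over an algebraically closed field *)

(** An induction principle: a property of functions that holds for the coordinates
    [g i] and is closed under sums and products holds for every polynomial in them.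
    Regularity, being polynomial along a curve, being a Laurent polynomial in a
    parameter and having a given denominator are all obtained this way. *)
Lemma meval_closed (K : fieldType) (A : Type) (P : (A -> K) -> Prop) (m : nat)
    (g : 'I_m -> A -> K) (p : {mpoly K[m]}) :
  (forall f h, f =1 h -> P f -> P h) ->
  (forall c, P (fun=> c)) ->
  (forall f h, P f -> P h -> P (fun a => f a + h a)) ->
  (forall f h, P f -> P h -> P (fun a => f a * h a)) ->
  (forall i, P (g i)) -> P (fun a => p.@[fun i => g i a]).
Proof.
move=> Pext Pc Pd Pm Pg; elim/mpolyind: p => [|c m' p _ _ IHp].
  by apply: Pext (Pc 0) => a; rewrite meval0.
pose F := fun s : seq 'I_m => fun a => \prod_(i <- s) g i a ^+ m' i.
have PX f j : P f -> P (fun a => f a ^+ j).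
  move=> Pf; elim: j => [|j IHj]; first by apply: Pext (Pc 1).
  by apply: Pext (Pm _ _ Pf IHj) => a; rewrite exprS.
have PF s : P (F s).
  elim: s => [|i s IHs]; first by apply: Pext (Pc 1) => a; rewrite /F big_nil.
  by apply: Pext (Pm _ _ (PX _ (m' i) (Pg i)) IHs) => a; rewrite /F big_cons.
apply: Pext (Pd _ _ (Pm _ _ (Pc c) (PF (index_enum _))) IHp) => a /=.
by rewrite mevalD mevalZ mevalX.
Qed.

Lemma poly_vanish_eq0 (K : closedFieldType) (p h : {poly K}) :
  h != 0 -> (forall t, h.[t] != 0 -> p.[t] = 0) -> p = 0.
Proof.
move=> h0 ph; have: p * h == 0.
  apply/idPn => /closed_nonrootP[t]; rewrite /root hornerM.
  by case: (eqVneq h.[t] 0) => [->|/ph->]; rewrite ?mul0r ?mulr0 eqxx.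
by rewrite mulf_eq0 (negbTE h0) orbF => /eqP.
Qed.

(** Makes Kronecker's substitution injective on monomials. *)
Lemma digits_inj (B m : nat) (d e : 'I_m -> nat) :
  (forall i, d i < B)%N -> (forall i, e i < B)%N ->
  (\sum_i d i * B ^ i = \sum_i e i * B ^ i)%N -> d =1 e.
Proof.
elim: m d e => [|m IH] d e dB eB; first by move=> _ [].
have B0 : (0 < B)%N by apply: leq_trans (dB ord0).
rewrite !big_ord_recl /= !expn0 !muln1.
have E (f : 'I_m.+1 -> nat) : (\sum_(i < m) f (lift ord0 i) * B ^ bump 0 i =
     (\sum_(i < m) f (lift ord0 i) * B ^ i) * B)%N.
  by rewrite big_distrl; apply: eq_bigr => i _; rewrite /= -mulnA -expnSr.
rewrite !E ![(_ + _ * B)%N]addnC => eqS.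
have h0 : d ord0 = e ord0.
  by move/(congr1 (modn^~ B)): (eqS); rewrite !modnMDl !modn_small.
have {}IH : (fun i => d (lift ord0 i)) =1 (fun i => e (lift ord0 i)).
  apply: IH => //.
  by move: eqS; rewrite h0 => /addIn/eqP; rewrite eqn_pmul2r // => /eqP.
by move=> i; case: (unliftP ord0 i) => [j|] ->; rewrite ?h0 ?IH.
Qed.

(** Kronecker's substitution v_i = t^(B^i) turns distinct monomials of p, whose
    exponents are below B, into distinct powers of t, so the univariate case
    applies. *)
Lemma mpoly_vanish_eq0 (K : closedFieldType) (m : nat) (p : {mpoly K[m]}) :
  (forall v : 'I_m -> K, (forall i, v i != 0) -> p.@[v] = 0) -> p = 0.
Proof.
move=> pv0; pose B := msize p.
pose code (u : 'X_{1..m}) : nat := (\sum_i u i * B ^ i)%N.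
pose q : {poly K} := \sum_(u <- msupp p) p@_u *: 'X^(code u).
have q0 : q = 0.
  apply: (@poly_vanish_eq0 _ _ 'X); rewrite ?polyX_eq0 // => t; rewrite hornerX => t0.
  rewrite -(pv0 (fun i => t ^+ (B ^ i))) => [|i]; last by rewrite expf_neq0.
  rewrite mevalE horner_sum; apply: eq_bigr => u _.
  rewrite hornerZ hornerXn; congr (_ * _).
  by rewrite /code expr_sum; apply: eq_bigr => i _; rewrite mulnC exprM.
apply/mpolyP => u; rewrite mcoeff0; apply/eqP/negPn; rewrite -mcoeff_msupp.
apply/negP => up; have /eqP := congr1 (fun r : {poly K} => r`_(code u)) q0.
rewrite coef0 /q coef_sum (bigD1_seq u) ?msupp_uniq //= coefZ coefXn eqxx mulr1.
rewrite big_seq_cond big1 ?addr0 => [|u' /andP[u'p ne]].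
  by rewrite mcoeff_eq0 up.
rewrite coefZ coefXn; case: eqP => [cE|]; last by rewrite mulr0.
have dig w : w \in msupp p -> forall i, (w i < B)%N.
  move=> /msize_mdeg_lt wB i; apply: leq_ltn_trans wB.
  by rewrite mdegE (bigD1 i) //= leq_addr.
case/eqP: ne; apply/mnmP.
by apply: (@digits_inj B) => //; [apply: dig | apply: dig].
Qed.

Lemma root_ex (K : closedFieldType) (c : K) (m : nat) : (0 < m)%N ->
  exists z : K, z ^+ m = c.
Proof.
move=> m0; have [z zE] := solve_monicpoly (fun i => if i == 0%N then c else 0) m0.
exists z; rewrite zE; case: m m0 {zE} => // m _; rewrite big_ord_recl /= mulr1 big1 ?addr0 //.
by move=> i _; rewrite mul0r.
Qed.

(** X^m + 1 has simple roots, so it divides A^m + 1, and the two differ by a scalar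
    for reasons of degree. Both derivatives then vanish at 0, that of A^m + 1 being
    m A^(m-1) A'; as A has degree 1, A(0) = 0. *)
Lemma affine_fix_roots (K : closedFieldType) (charK : [pchar K] =i pred0)
    (m : nat) (A : {poly K}) : (2 <= m)%N -> size A = 2 ->
  (forall z : K, z ^+ m = -1 -> A.[z] ^+ m = -1) -> A.[0] = 0.
Proof.
move=> m2 sA Aroot; have m0 : (0 < m)%N by apply: leq_trans m2.
have mK : m%:R != 0 :> K by rewrite ((pcharf0P K).1 charK) -lt0n.
pose P : {poly K} := 'X^m + 1; pose Q := A ^+ m + 1.
have rootP z : root P z = (z ^+ m == -1).
  by rewrite /root hornerD hornerXn hornerC addr_eq0.
have sP : size P = m.+1 by rewrite /P -[1]opprK -polyC1 -polyCN size_XnsubC.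
have sQ : size Q = m.+1.
  have sAm : size (A ^+ m) = m.+1.
    have := size_exp A m; rewrite sA mul1n => /(congr1 S); rewrite prednK //.
    by rewrite lt0n size_poly_eq0 expf_neq0 // -size_poly_eq0 sA.
  by rewrite size_polyDl sAm // size_poly1.
have PQ : P %| Q.
  pose g := gcdp P Q; have gP : g %| P by apply: dvdp_gcdl.
  pose h := P %/ g; have PE : P = h * g by rewrite divpK.
  (* A root of the cofactor h is also a root of the gcd, hence a double root of P,
     hence 0, which is not a root of P. *)
  have [/eqP sh|] := boolP (size h == 1%N); last first.
    move=> /closed_rootP[z hz]; have Pz : root P z by rewrite PE rootM hz.
    have zm : z ^+ m = -1 by apply/eqP; rewrite -rootP.
    have gz : root g z.
      rewrite root_gcd Pz /root hornerD horner_exp hornerC addr_eq0.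
      by rewrite (Aroot _ zm) eqxx.
    have : (P^`()).[z] = 0.
      by rewrite PE derivM hornerD !hornerM (eqP hz) (eqP gz) mulr0 mul0r addr0.
    rewrite /P derivD derivXn derivC addr0 hornerMn hornerXn -mulr_natl => /eqP.
    rewrite mulf_eq0 (negbTE mK) /= expf_eq0 => /andP[_ /eqP z0].
    move: Pz; rewrite rootP z0 expr0n gtn_eqF // eq_sym oppr_eq0 oner_eq0 //.
  have : h %= 1 by rewrite -size_poly_eq1 sh.
  move=> h1; have := eqp_mulr g h1; rewrite -PE mul1r => /eqp_dvdl->.
  exact: dvdp_gcdr.
have := dvdp_size_eqp PQ; rewrite sP sQ eqxx => /esym/eqpP[[c1 c2] /= /andP[c10 c20] E].
have := congr1 (fun p : {poly K} => (p^`()).[0]) E.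
rewrite /= !derivZ /P /Q !derivD derivXn derivC !addr0 deriv_exp !hornerZ.
rewrite hornerMn hornerXn expr0n -subn1 subn_eq0 leqNgt m2 mul0rn mulr0.
rewrite hornerMn hornerM => /esym/eqP; rewrite mulf_eq0 (negbTE c20) /=.
rewrite -mulr_natl mulf_eq0 (negbTE mK) /= mulf_eq0 => /orP[/eqP|].
  have [p pE] : exists p : K * K, A = p.1%:P + p.2 *: 'X.
    exists (A`_0, A`_1); apply/polyP => i; rewrite coefD coefC coefZ coefX /=.
    case: i => [|[|i]] /=; rewrite ?mulr0 ?addr0 ?add0r ?mulr1 //.
    by rewrite nth_default // sA.
  rewrite pE derivD derivC add0r derivZ derivX hornerZ hornerC mulr1 => p2.
  by move: sA; rewrite pE p2 scale0r addr0 size_polyC; case: eqP.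
by rewrite horner_exp expf_eq0 => /andP[_ /eqP].
Qed.

(** * Regular functions *)

Section Regular.
Variables (K : fieldType) (X : affset K).
Implicit Types f g : point X -> K.

Lemma reg_ext f g : f =1 g -> regular_fun f -> regular_fun g.
Proof. by move=> fg [p pf]; exists p => v; rewrite -fg. Qed.

Lemma reg_coord i : regular_fun (fun v : point X => v i).
Proof. by exists 'X_i => v; rewrite mevalXU. Qed.

Lemma reg_const c : regular_fun (fun _ : point X => c).
Proof. by exists c%:MP => v; rewrite mevalC. Qed.

Lemma reg_add f g :
  regular_fun f -> regular_fun g -> regular_fun (fun v => f v + g v).
Proof. by move=> [p pf] [q qg]; exists (p + q) => v; rewrite mevalD -pf -qg. Qed.

Lemma reg_mul f g :
  regular_fun f -> regular_fun g -> regular_fun (fun v => f v * g v).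
Proof. by move=> [p pf] [q qg]; exists (p * q) => v; rewrite mevalM -pf -qg. Qed.

Lemma reg_opp f : regular_fun f -> regular_fun (fun v => - f v).
Proof. by move=> [p pf]; exists (- p) => v; rewrite mevalN -pf. Qed.

Lemma reg_sub f g :
  regular_fun f -> regular_fun g -> regular_fun (fun v => f v - g v).
Proof. by move=> rf rg; apply: reg_add => //; apply: reg_opp. Qed.

Lemma reg_sum (I : Type) (s : seq I) (P : pred I) (F : I -> point X -> K) :
  (forall i, regular_fun (F i)) ->
  regular_fun (fun v => \sum_(i <- s | P i) F i v).
Proof.
move=> rF; elim: s => [|i s IH].
  by apply: reg_ext (reg_const 0) => v; rewrite big_nil.
have := reg_add (rF i) IH; case Pi: (P i) => r.
  by apply: reg_ext r => v; rewrite big_cons Pi.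
by apply: reg_ext IH => v; rewrite big_cons Pi.
Qed.

Lemma reg_prod (I : Type) (s : seq I) (P : pred I) (F : I -> point X -> K) :
  (forall i, regular_fun (F i)) ->
  regular_fun (fun v => \prod_(i <- s | P i) F i v).
Proof.
move=> rF; elim: s => [|i s IH].
  by apply: reg_ext (reg_const 1) => v; rewrite big_nil.
have := reg_mul (rF i) IH; case Pi: (P i) => r.
  by apply: reg_ext r => v; rewrite big_cons Pi.
by apply: reg_ext IH => v; rewrite big_cons Pi.
Qed.

Lemma reg_exp f j : regular_fun f -> regular_fun (fun v => f v ^+ j).
Proof.
move=> rf; apply: reg_ext (reg_prod (index_enum 'I_j) xpredT (fun=> rf)) => v.
by rewrite prodr_const card_ord.
Qed.

Lemma reg_poly f (p : {poly K}) :
  regular_fun f -> regular_fun (fun v => p.[f v]).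
Proof.
move=> rf; apply: (@reg_ext (fun v => \sum_(i < size p) p`_i * f v ^+ i)).
  by move=> v; rewrite horner_coef.
by apply: reg_sum => i; apply: reg_mul (reg_const _) (reg_exp _ rf).
Qed.

End Regular.

Lemma reg_comp (K : fieldType) (X Y : affset K) (f : point Y -> K)
    (g : point X -> point Y) :
  regular_map g -> regular_fun f -> regular_fun (fun v => f (g v)).
Proof.
move=> rg [p pf].
apply: (@reg_ext _ _ (fun v => p.@[fun i => g v i])) => [v|]; first by rewrite pf.
apply: (@meval_closed K (point X) (@regular_fun K X) _ (fun i v => g v i)).
- exact: reg_ext.
- exact: reg_const.
- exact: reg_add.
- exact: reg_mul.
- exact: rg.
Qed.

Lemma regmap_comp (K : fieldType) (X Y Z : affset K) (f : point Y -> point Z)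
    (g : point X -> point Y) :
  regular_map g -> regular_map f -> regular_map (fun v => f (g v)).
Proof. by move=> rg rf i; apply: (reg_comp rg (rf i)). Qed.

Lemma regmap_id (K : fieldType) (X : affset K) :
  regular_map (fun v : point X => v).
Proof. by move=> i; apply: reg_coord. Qed.

Lemma reg_proj1 (K : fieldType) (X Y : affset K) : regular_map (@proj1p K X Y).
Proof.
move=> i; apply: reg_ext (reg_coord (X := affprod X Y) (lshift _ i)) => v.
by rewrite ffunE.
Qed.

Lemma reg_proj2 (K : fieldType) (X Y : affset K) : regular_map (@proj2p K X Y).
Proof.
move=> i; apply: reg_ext (reg_coord (X := affprod X Y) (rshift _ i)) => v.
by rewrite ffunE.
Qed.

(** * The varieties, in coordinates *)

Definition mon (R : comNzRingType) (m : nat) (e : 'I_m -> nat) (y : 'I_m -> R) : R :=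
  \prod_i y i ^+ e i.

(** The exponent 1 of T_11 followed by the exponents of the remaining T_1j. *)
Definition cons1 (k : nat) (a : 'I_k -> nat) (j : 'I_k.+1) : nat :=
  if unlift ord0 j is Some i then a i else 1%N.

Local Notation variety K a b :=
  (affprod (trinomial_hypersurface K (cons1 a) b) (affine_line K)).

Section Coordinates.
Variables (K : fieldType) (k n : nat) (a : 'I_k -> nat) (b : 'I_n.+1 -> nat).
Local Notation V := (variety K a b).

Definition ix : 'I_(k.+1 + n.+1 + 1) := lshift 1 (lshift n.+1 ord0).
Definition iy (j : 'I_k) : 'I_(k.+1 + n.+1 + 1) :=
  lshift 1 (lshift n.+1 (lift ord0 j)).
Definition iz (j : 'I_n.+1) : 'I_(k.+1 + n.+1 + 1) := lshift 1 (rshift k.+1 j).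
Definition iw : 'I_(k.+1 + n.+1 + 1) := rshift (k.+1 + n.+1) ord0.

Lemma index_cases (P : 'I_(k.+1 + n.+1 + 1) -> Prop) :
  P ix -> (forall j, P (iy j)) -> (forall j, P (iz j)) -> P iw -> forall i, P i.
Proof.
move=> Px Py Pz Pw i; rewrite -(splitK i); case: (split i) => [i'|j] /=; last first.
  by rewrite (ord1 j).
rewrite -(splitK i'); case: (split i') => [j|j] /=; last exact: Pz.
by case: (unliftP ord0 j) => [j'|] ->; [apply: Py | apply: Px].
Qed.

Definition px (v : point V) : K := v ix.
Definition py (v : point V) (j : 'I_k) : K := v (iy j).
Definition pz (v : point V) (j : 'I_n.+1) : K := v (iz j).
Definition pw (v : point V) : K := v iw.

Lemma eq_mon (R : comNzRingType) m (e : 'I_m -> nat) (y y' : 'I_m -> R) :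
  y =1 y' -> mon e y = mon e y'.
Proof. by move=> yy; apply: eq_bigr => i _; rewrite yy. Qed.

Lemma on_variety (u : {ffun 'I_(k.+1 + n.+1 + 1) -> K}) :
  @on_affset K V u =
  (u ix * mon a (fun j => u (iy j)) == mon b (fun j => u (iz j)) + 1).
Proof.
rewrite /on_affset /= andbT comp_mpoly_meval.
rewrite mevalB mevalD meval1 !rmorph_prod /= subr_eq0 big_ord_recl.
congr (_ * _ == _ + 1).
- by rewrite rmorphXn /= mevalXU tnth_mktuple mevalXU /cons1 unlift_none.
- apply: eq_bigr => j _.
  by rewrite rmorphXn /= mevalXU tnth_mktuple mevalXU /cons1 liftK.
- by apply: eq_bigr => j _; rewrite rmorphXn /= mevalXU tnth_mktuple mevalXU.
Qed.

Lemma equation (v : point V) : px v * mon a (py v) = mon b (pz v) + 1.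
Proof. by apply/eqP; have := coordP v; rewrite on_variety. Qed.

Lemma point_ext (v v' : point V) :
  px v = px v' -> py v =1 py v' -> pz v =1 pz v' -> pw v = pw v' -> v = v'.
Proof.
by move=> ex ey ez ew; apply/val_inj/ffunP; apply: index_cases.
Qed.

Definition vcoord (x : K) (y : 'I_k -> K) (z : 'I_n.+1 -> K) (w : K) :
    {ffun 'I_(k.+1 + n.+1 + 1) -> K} :=
  [ffun i => match split i with
             | inl i' => match split i' with
                         | inl j => oapp y x (unlift ord0 j)
                         | inr j => z j
                         end
             | inr _ => w
             end].

Lemma vcoord_x x y z w : vcoord x y z w ix = x.
Proof.
rewrite ffunE -[ix]/(unsplit (inl _)) unsplitK.
by rewrite -[lshift _ _]/(unsplit (inl _)) unsplitK unlift_none.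
Qed.

Lemma vcoord_y x y z w j : vcoord x y z w (iy j) = y j.
Proof.
rewrite ffunE -[iy _]/(unsplit (inl _)) unsplitK.
by rewrite -[lshift _ _]/(unsplit (inl _)) unsplitK liftK.
Qed.

Lemma vcoord_z x y z w j : vcoord x y z w (iz j) = z j.
Proof.
rewrite ffunE -[iz _]/(unsplit (inl _)) unsplitK.
by rewrite -[rshift _ _]/(unsplit (inr _)) unsplitK.
Qed.

Lemma vcoord_w x y z w : vcoord x y z w iw = w.
Proof. by rewrite ffunE -[iw]/(unsplit (inr _)) unsplitK. Qed.

Lemma vcoordP x y z w : x * mon a y = mon b z + 1 ->
  @on_affset K V (vcoord x y z w).
Proof.
move=> eqn; rewrite on_variety vcoord_x (eq_mon _ (vcoord_y x y z w)).
by rewrite (eq_mon _ (vcoord_z x y z w)) eqn.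
Qed.

Definition mkpt x y z w (e : x * mon a y = mon b z + 1) : point V :=
  @Point K V _ (vcoordP w e).

Section Mkpt.
Variables (x : K) (y : 'I_k -> K) (z : 'I_n.+1 -> K) (w : K).
Hypothesis e : x * mon a y = mon b z + 1.
Lemma px_mkpt : px (mkpt w e) = x. Proof. exact: vcoord_x. Qed.
Lemma py_mkpt : py (mkpt w e) =1 y. Proof. exact: vcoord_y. Qed.
Lemma pz_mkpt : pz (mkpt w e) =1 z. Proof. exact: vcoord_z. Qed.
Lemma pw_mkpt : pw (mkpt w e) = w. Proof. exact: vcoord_w. Qed.
End Mkpt.
Definition mkptE := (px_mkpt, py_mkpt, pz_mkpt, pw_mkpt).

Lemma reg_px : regular_fun px. Proof. exact: reg_coord. Qed.
Lemma reg_py j : regular_fun (py^~ j). Proof. exact: reg_coord. Qed.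
Lemma reg_pz j : regular_fun (pz^~ j). Proof. exact: reg_coord. Qed.
Lemma reg_pw : regular_fun pw. Proof. exact: reg_coord. Qed.

Lemma reg_mon (X : affset K) m (e : 'I_m -> nat) (y : point X -> 'I_m -> K) :
  (forall j, regular_fun (y^~ j)) -> regular_fun (fun v => mon e (y v)).
Proof. by move=> ry; apply: reg_prod => j; apply: reg_exp. Qed.

Lemma regmap_variety (X : affset K) (f : point X -> point V) :
  regular_fun (fun v => px (f v)) ->
  (forall j, regular_fun (fun v => py (f v) j)) ->
  (forall j, regular_fun (fun v => pz (f v) j)) ->
  regular_fun (fun v => pw (f v)) -> regular_map f.
Proof. by move=> *; apply: index_cases. Qed.

(** [meval_closed] for regular functions along a family of points [g]: it
    is enough to know the coordinates of the family. *)
Lemma meval_variety (A : Type) (P : (A -> K) -> Prop) (g : A -> point V)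
    (F : point V -> K) :
  (forall f h, f =1 h -> P f -> P h) ->
  (forall c, P (fun=> c)) ->
  (forall f h, P f -> P h -> P (fun a => f a + h a)) ->
  (forall f h, P f -> P h -> P (fun a => f a * h a)) ->
  P (fun t => px (g t)) -> (forall j, P (fun t => py (g t) j)) ->
  (forall j, P (fun t => pz (g t) j)) -> P (fun t => pw (g t)) ->
  regular_fun F -> P (fun t => F (g t)).
Proof.
move=> Pext Pc Pd Pm Px Py Pz Pw [p pF].
apply: (Pext (fun t => p.@[fun i => g t i])) => [t|]; first by rewrite pF.
apply: (@meval_closed K A P _ (fun i t => g t i)) => //.
exact: index_cases.
Qed.
End Coordinates.

Ltac reg := repeat first
  [ apply: reg_px | apply: reg_py | apply: reg_pz | apply: reg_pw
  | apply: reg_const | apply: reg_sub | apply: reg_add | apply: reg_opp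
  | apply: reg_mul | apply: reg_exp | apply: reg_poly
  | apply: reg_sum => ? | apply: reg_prod => ? | apply: reg_mon => ? ].

(** * Density of the locus where the coordinates y, z, w do not vanish *)

Lemma binom_order2 (R : comNzRingType) (q : R) (m : nat) :
  exists r : R, (1 + q) ^+ m = 1 + m%:R * q + q ^+ 2 * r.
Proof.
elim: m => [|m [r IH]]; first by exists 0; rewrite mul0r mulr0 !addr0.
by exists (m%:R + (1 + q) * r); rewrite exprS IH mulrSr; ring.
Qed.

Lemma mon0 (R : comNzRingType) m (e : 'I_m -> nat) (y : 'I_m -> R) j :
  (0 < e j)%N -> y j = 0 -> mon e y = 0.
Proof.
by move=> ej yj; rewrite /mon (bigD1 j) //= yj expr0n eqn0Ngt ej mul0r.
Qed.

Lemma mon_neq0 (K : fieldType) m (e : 'I_m -> nat) (y : 'I_m -> K) :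
  (forall j, y j != 0) -> mon e y != 0.
Proof. by move=> y0; apply/prodf_neq0 => j _; rewrite expf_neq0. Qed.

Lemma monM (R : comNzRingType) m (e : 'I_m -> nat) (y y' : 'I_m -> R) :
  mon e (fun j => y j * y' j) = mon e y * mon e y'.
Proof. by rewrite -big_split; apply: eq_bigr => j _; rewrite exprMn. Qed.

Lemma mon1 (R : comNzRingType) m (e : 'I_m -> nat) : mon e (fun=> 1 : R) = 1.
Proof. by rewrite /mon big1 // => j _; rewrite expr1n. Qed.

Lemma horner_mon (K : fieldType) m (e : 'I_m -> nat) (y : 'I_m -> {poly K}) t :
  (mon e y).[t] = mon e (fun j => (y j).[t]).
Proof. by rewrite horner_prod; apply: eq_bigr => j _; rewrite horner_exp. Qed.

Section Density.
Variables (K : closedFieldType) (k n : nat).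
Variables (a : 'I_k -> nat) (b : 'I_n.+1 -> nat).
Hypotheses (charK : [pchar K] =i pred0).
Hypotheses (a_gt0 : forall j, (0 < a j)%N) (b_gt0 : forall j, (0 < b j)%N).
Local Notation V := (variety K a b).

Lemma natK_neq0 m : (0 < m)%N -> m%:R != 0 :> K.
Proof. by move=> m0; rewrite ((pcharf0P K).1 charK) -lt0n. Qed.

Definition generic (v : point V) :=
  [/\ forall j, py v j != 0, forall j, pz v j != 0 & pw v != 0].

(** A regular function becomes a polynomial in the parameter of a polynomial curve.
    If the curve is generic for almost all values of the parameter, that polynomial
    vanishes, in particular at the point of parameter 0. *)
Lemma curve_density (x : {poly K}) (y : 'I_k -> {poly K})
    (z : 'I_n.+1 -> {poly K}) (w : {poly K}) (v : point V) (F : point V -> K) :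
  (x * mon a y = mon b z + 1) ->
  (forall j, y j != 0) -> (forall j, z j != 0) -> w != 0 ->
  px v = x.[0] -> (forall j, py v j = (y j).[0]) ->
  (forall j, pz v j = (z j).[0]) -> pw v = w.[0] ->
  regular_fun F -> (forall u, generic u -> F u = 0) -> F v = 0.
Proof.
move=> eqn y0 z0 w0 vx vy vz vw rF Fgen.
have e t : x.[t] * mon a (fun j => (y j).[t]) = mon b (fun j => (z j).[t]) + 1.
  by rewrite -!horner_mon -hornerM eqn hornerD hornerC.
pose g t := mkpt w.[t] (e t).
have [p pF] : exists p : {poly K}, forall t, F (g t) = p.[t].
  apply: (@meval_variety K k n a b K
    (fun h => exists p : {poly K}, forall t, h t = p.[t]) g) => //.
  - by move=> f h fh [p pf]; exists p => t; rewrite -fh.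
  - by move=> c; exists c%:P => t; rewrite hornerC.
  - by move=> f h [p pf] [q qh]; exists (p + q) => t; rewrite hornerD pf qh.
  - by move=> f h [p pf] [q qh]; exists (p * q) => t; rewrite hornerM pf qh.
  - by exists x => t; rewrite mkptE.
  - by move=> j; exists (y j) => t; rewrite mkptE.
  - by move=> j; exists (z j) => t; rewrite mkptE.
  - by exists w => t; rewrite mkptE.
have -> : v = g 0 by apply: point_ext => [|j|j|]; rewrite mkptE.
suff p0 : p = 0 by rewrite pF p0 horner0.
apply: (@poly_vanish_eq0 _ _ ((\prod_j y j) * (\prod_j z j) * w)).
  rewrite !mulf_neq0 //; first by apply/prodf_neq0 => j _.
  by apply/prodf_neq0 => j _.
move=> t; rewrite !hornerM !horner_prod !mulf_eq0 !negb_or => /andP[/andP[yt zt] wt].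
rewrite -pF Fgen //; split=> [j|j|]; rewrite mkptE //.
  by move/prodf_neq0: yt => ->.
by move/prodf_neq0: zt => ->.
Qed.

(** Through every point v there is a polynomial curve whose general point is
    generic. If y has no zero, move z and w freely and solve for x. Otherwise
    z^b = -1, so z has no zero; move y and w, and correct z_0 and x so that the
    equation holds identically. *)
Lemma density (F : point V -> K) (v : point V) :
  regular_fun F -> (forall u, generic u -> F u = 0) -> F v = 0.
Proof.
move=> rF Fgen; have eqn := equation v.
have Xa0 c : c%:P + 'X != 0 :> {poly K}.
  by rewrite addrC -size_poly_eq0 size_XaddC.
have [/existsP[j0 /eqP y0]|] := boolP [exists j, py v j == 0]; last first.
  rewrite negb_exists => /forallP ynz; have mnz := mon_neq0 a ynz.
  pose z j : {poly K} := (pz v j)%:P + 'X.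
  apply: (@curve_density ((mon a (py v))^-1 *: (mon b z + 1))
    (fun j => (py v j)%:P) z ((pw v)%:P + 'X)) => //.
  - have -> : mon a (fun j => (py v j)%:P) = (mon a (py v))%:P.
      by rewrite rmorph_prod; apply: eq_bigr => j _; rewrite rmorphXn.
    by rewrite mulrC mul_polyC scalerA mulfV ?scale1r.
  - by move=> j; rewrite polyC_eq0.
  - by move=> j; apply: Xa0.
  - rewrite hornerZ hornerD hornerC horner_mon.
    rewrite (eq_mon _ (y' := pz v)) => [|j]; last by rewrite hornerD hornerC hornerX addr0.
    by rewrite -eqn mulrCA mulVf ?mulr1.
  - by move=> j; rewrite hornerC.
  - by move=> j; rewrite hornerD hornerC hornerX addr0.
  - by rewrite hornerD hornerC hornerX addr0.
have ma0 : mon a (py v) = 0 by apply: mon0 y0.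
have mb : mon b (pz v) = -1.
  by move/eqP: eqn; rewrite ma0 mulr0 eq_sym addr_eq0 => /eqP.
have znz j : pz v j != 0.
  apply/eqP => zj; move/eqP: mb; rewrite (mon0 (b_gt0 j) zj).
  by rewrite eq_sym oppr_eq0 oner_eq0.
(* With q = x y(t)^a, taking the approximate root 1 - q / b_0 of 1 - q as factor of
   z_0 gives z(t)^b + 1 = q - c q^2 r with c constant, which is still divisible by
   y(t)^a; the quotient is x(t), and x(0) = x since q vanishes at t = 0. *)
have b0 := natK_neq0 (b_gt0 ord0).
pose y j : {poly K} := (py v j)%:P + 'X.
pose q := (px v)%:P * mon a y.
pose cb : {poly K} := (b ord0)%:R^-1%:P.
have [r rE] := binom_order2 (- (cb * q)) (b ord0).
pose z j : {poly K} := (pz v j)%:P *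
  (if j == ord0 then 1 - cb * q else 1).
have q0 : q.[0] = 0.
  rewrite hornerM horner_mon (mon0 (a_gt0 j0)) ?mulr0 //.
  by rewrite hornerD hornerC hornerX addr0.
pose x := (px v)%:P - (px v)%:P * q * (cb ^+ 2 * r).
apply: (@curve_density x y z ((pw v)%:P + 'X)) => //.
- have -> : mon b z = - (1 - q + q ^+ 2 * (cb ^+ 2 * r)).
    rewrite monM [X in _ * X](bigD1 ord0) //= big1 => [|j /negbTE->]; last first.
      by rewrite expr1n.
    have -> : mon b (fun j => (pz v j)%:P) = (mon b (pz v))%:P.
      by rewrite rmorph_prod; apply: eq_bigr => j _; rewrite rmorphXn.
    rewrite mb mulr1 rmorphN mulN1r rE; congr (- _).
    have -> : (b ord0)%:R * - (cb * q) = - q.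
      rewrite mulrN mulrA -[_%:R * cb](_ : 1 = _) ?mul1r //.
      by rewrite -polyC_natr -rmorphM mulfV.
    ring.
  by rewrite /x mulrBl -!/q; rewrite /q; ring.
- by move=> j; apply: Xa0.
- move=> j; rewrite /z mulf_neq0 //; first by rewrite polyC_eq0.
  case: (j =P ord0) => _; last by rewrite oner_eq0.
  apply/eqP => /(congr1 (horner^~ 0)) /eqP.
  by rewrite hornerD hornerN hornerM q0 mulr0 !hornerC subr0 oner_eq0.
- by rewrite /x hornerD hornerN -mulrA hornerM [X in _ * X]hornerM q0 mul0r mulr0 hornerC subr0.
- by move=> j; rewrite hornerD hornerC hornerX addr0.
- move=> j; rewrite /z hornerM hornerC; case: eqP => _; last by rewrite hornerC mulr1.
  by rewrite hornerD hornerN hornerM q0 mulr0 !hornerC subr0 mulr1.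
- by rewrite hornerD hornerC hornerX addr0.
Qed.

Lemma density_eq (F G : point V -> K) (v : point V) :
  regular_fun F -> regular_fun G -> (forall u, generic u -> F u = G u) ->
  F v = G v.
Proof.
move=> rF rG FG; apply/eqP; rewrite -subr_eq0; apply/eqP.
by apply: (density v (reg_sub rF rG)) => u /FG->; rewrite subrr.
Qed.

Lemma regmap_density (Z : affset K) (p q : point V -> point Z) (v : point V) :
  regular_map p -> regular_map q -> (forall u, generic u -> p u = q u) ->
  p v = q v.
Proof.
move=> rp rq pq; apply/val_inj/ffunP => i.
by apply: (density_eq v (rp i) (rq i)) => u /pq->.
Qed.

End Density.

(** * Independence of X from the exponents of y *)

(** A truncation of the power series (1 - X)^(-1/b), obtained one coefficient
    at a time: adding c X^N to the current root changes its b-th power by b c X^N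
    modulo X^(N+1). *)
Lemma truncated_root (K : fieldType) (charK : [pchar K] =i pred0) (b N : nat) :
  (0 < b)%N -> (0 < N)%N -> exists f g : {poly K},
  (1 - 'X) * (1 + 'X * f) ^+ b = 1 - 'X ^+ N * g.
Proof.
move=> b0; have bK : b%:R != 0 :> K by rewrite ((pcharf0P K).1 charK) -lt0n.
elim: N => // -[|N] IH _; first by exists 0, 1; rewrite mulr0 addr0 expr1n !mulr1.
have [f [g fg]] := IH isT.
pose c := g.[0] / b%:R.
pose A := 1 + 'X * f; pose B := A + 'X ^+ N.+1 * c%:P.
pose S := \sum_(i < b) B ^+ (b.-1 - i) * A ^+ i.
have BA : B ^+ b - A ^+ b = 'X ^+ N.+1 * c%:P * S by rewrite subrXX addrC addKr.
have /factor_theorem[h hE] : root (g - (1 - 'X) * c%:P * S) 0.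
  rewrite /root hornerD hornerN !hornerM hornerD hornerN !hornerC hornerX subr0.
  rewrite mul1r /S horner_sum (eq_bigr (fun=> 1)) => [|i _].
    by rewrite sumr_const card_ord divfK ?subrr.
  rewrite hornerM !horner_exp /B /A hornerD !hornerM hornerC hornerXn expr0n mul0r.
  by rewrite hornerD hornerC hornerM hornerX mul0r !addr0 !expr1n mulr1.
exists (f + 'X ^+ N * c%:P), h.
have -> : 1 + 'X * (f + 'X ^+ N * c%:P) = B by rewrite /B /A exprS; ring.
have -> : B ^+ b = A ^+ b + 'X ^+ N.+1 * c%:P * S by rewrite -BA; ring.
rewrite mulrDr fg; have -> : g = h * 'X + (1 - 'X) * c%:P * S.
  by rewrite -[X in h * X]subr0 -hE subrK.
by rewrite [in RHS]exprS; ring.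
Qed.

(** Let m = y^a and m' = y^a', where m divides m' and m' divides m^N. The points of
    the two varieties correspond when they have the same y and both congruences
    z_0' = z_0 mod m and p(z') = 0 mod m' hold, p = z^b + 1; the coordinates on the
    lines record the differences. On the first variety p(z) = x m, and z_0 phi(x m),
    with phi = (1 - X)^(-1/b_0) truncated at order N, is a root of p modulo m' lifting
    z_0. So set z_0' = z_0 phi(x m) + m' w and w' = (z_0 - z_0') / m. In the
    opposite direction z_0 = z_0' + m w', and
    w = (z_0' - z_0 phi(x m)) / m'. *)
Section Danielewski.
Variables (K : closedFieldType) (k n : nat).
Variables (a a' : 'I_k -> nat) (b : 'I_n.+1 -> nat) (N : nat).
Hypotheses (charK : [pchar K] =i pred0).
Hypotheses (a_gt0 : forall j, (0 < a j)%N) (b_gt0 : forall j, (0 < b j)%N).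
Hypotheses (le_aa' : forall j, (a j <= a' j)%N)
  (le_a'N : forall j, (a' j <= N * a j)%N).
Local Notation X := (variety K a b).
Local Notation Y := (variety K a' b).

Definition upd (z : 'I_n.+1 -> K) (u : K) : 'I_n.+1 -> K :=
  fun j => if j == ord0 then u else z j.

Definition cof (z : 'I_n.+1 -> K) : K :=
  \prod_(j < n) z (lift ord0 j) ^+ b (lift ord0 j).

Lemma mon_upd z u : mon b (upd z u) = u ^+ b ord0 * cof z.
Proof. by rewrite /mon big_ord_recl. Qed.

Lemma mon_cof z : mon b z = z ord0 ^+ b ord0 * cof z.
Proof. by rewrite /mon big_ord_recl. Qed.

(** The quotients m' / m and m^N / m'. *)
Definition m1 (y : 'I_k -> K) := mon (fun j => a' j - a j)%N y.
Definition m2 (y : 'I_k -> K) := mon (fun j => N * a j - a' j)%N y.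

Lemma mon_a' y : mon a' y = mon a y * m1 y.
Proof. by rewrite -big_split; apply: eq_bigr => j _; rewrite /= -exprD subnKC. Qed.

Lemma mon_aN y : mon a y ^+ N = mon a' y * m2 y.
Proof.
rewrite -prodrXl -big_split; apply: eq_bigr => j _ /=.
by rewrite -exprD subnKC // mulnC exprM.
Qed.

Definition geom (u u' : K) : K :=
  \sum_(i < b ord0) u ^+ ((b ord0).-1 - i) * u' ^+ i.

Lemma geomP u u' : u ^+ b ord0 - u' ^+ b ord0 = (u - u') * geom u u'.
Proof. exact: subrXX. Qed.

Variables f g : {poly K}.
Hypothesis fg : (1 - 'X) * (1 + 'X * f) ^+ b ord0 = 1 - 'X ^+ N * g.

Lemma fgE q : (1 - q) * (1 + q * f.[q]) ^+ b ord0 = 1 - q ^+ N * g.[q].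
Proof.
by have := congr1 (horner^~ q) fg; rewrite /= !(hornerE, horner_exp, hornerXn).
Qed.

Section ToFun.
Implicit Types v : point X.
Definition to_q v := px v * mon a (py v).
Definition to_A v := pz v ord0 * (1 + to_q v * f.[to_q v]).
Definition to_z0 v := to_A v + mon a' (py v) * pw v.
Definition to_x v := m2 (py v) * px v ^+ N * g.[to_q v] +
  cof (pz v) * pw v * geom (to_z0 v) (to_A v).
Definition to_w v := - (pz v ord0 * px v * f.[to_q v]) - m1 (py v) * pw v.

Lemma to_eqn v : to_x v * mon a' (py v) = mon b (upd (pz v) (to_z0 v)) + 1.
Proof.
rewrite mon_upd.
have -> : to_z0 v ^+ b ord0 = to_A v ^+ b ord0 +
    mon a' (py v) * pw v * geom (to_z0 v) (to_A v).
  by apply/eqP; rewrite -subr_eq0 opprD addrA geomP {1}/to_z0 [to_A v + _]addrC addrK subrr.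
rewrite /to_x; set G := geom _ _.
have Q := fgE (to_q v); have E := equation v; rewrite -/(to_q v) mon_cof in E.
have {}E : pz v ord0 ^+ b ord0 * cof (pz v) = to_q v - 1 by rewrite E addrK.
have : to_A v ^+ b ord0 * cof (pz v) + 1 =
   px v ^+ N * (mon a' (py v) * m2 (py v)) * g.[to_q v].
  rewrite -mon_aN -exprMn -/(to_q v) exprMn mulrAC E.
  apply/eqP; rewrite -subr_eq0 -[_ * g.[_]](subKr 1) -Q; apply/eqP; ring.
by move=> E'; rewrite [in RHS]mulrDl addrAC E'; ring.
Qed.

Definition danielewski_fun v : point Y := mkpt (to_w v) (to_eqn v).

Lemma danielewski_regular : regular_map danielewski_fun.
Proof.
apply: regmap_variety => [|j|j|].
- apply: (@reg_ext _ _ to_x) => [v|]; rewrite ?mkptE //.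
  by rewrite /to_x /geom /to_z0 /to_A /to_q /m2 /cof; reg.
- by apply: (@reg_ext _ X (fun v => py v j)) => [v|]; rewrite ?mkptE //; reg.
- apply: (@reg_ext _ _ (fun v => upd (pz v) (to_z0 v) j)) => [v|]; rewrite ?mkptE //.
  rewrite /upd; case: eqP => _; last by reg.
  by rewrite /to_z0 /to_A /to_q; reg.
- apply: (@reg_ext _ _ to_w) => [v|]; rewrite ?mkptE //.
  by rewrite /to_w /to_q /m1; reg.
Qed.

Lemma to_wE v : mon a (py v) * to_w v = pz v ord0 - to_z0 v.
Proof.
rewrite /to_z0 mon_a' /to_A /to_w; set F := f.[_]; rewrite /to_q; ring.
Qed.

End ToFun.

Section FromFun.
Implicit Types v : point Y.
Definition of_z0 v := pz v ord0 + mon a (py v) * pw v.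
Definition of_x v :=
  m1 (py v) * px v + cof (pz v) * pw v * geom (of_z0 v) (pz v ord0).

Lemma of_eqn v : of_x v * mon a (py v) = mon b (upd (pz v) (of_z0 v)) + 1.
Proof.
rewrite mon_upd.
have -> : of_z0 v ^+ b ord0 = pz v ord0 ^+ b ord0 +
    mon a (py v) * pw v * geom (of_z0 v) (pz v ord0).
  by apply/eqP; rewrite -subr_eq0 opprD addrA geomP {1}/of_z0 [pz v _ + _]addrC addrK subrr.
rewrite /of_x; set G := geom _ _.
have E := equation v; rewrite mon_a' mon_cof in E.
rewrite [in RHS]mulrDl addrAC -E; ring.
Qed.

Definition of_q v := of_x v * mon a (py v).
Definition of_A v := of_z0 v * (1 + of_q v * f.[of_q v]).

(** The function w of the inverse map is regular by uniqueness of Hensel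
    lifts: z_0' and z_0 phi are both roots of p modulo m', they agree modulo m, and
    the derivative of p is invertible modulo m, because z_0 p' = b_0 z^b = -b_0 where p
    vanishes. Concretely their difference r satisfies r = m e r + m' h, and this
    relation is iterated until m^N, a multiple of m', appears. *)
Lemma inverse_w_regular : {h : point Y -> K | regular_fun h &
  forall v, mon a' (py v) * h v = pz v ord0 - of_A v}.
Proof.
pose r1 v := - (pw v + of_z0 v * of_x v * f.[of_q v]).
pose r v := pz v ord0 - of_A v.
have rE v : r v = mon a (py v) * r1 v.
  rewrite /r /of_A /r1; set F := f.[_]; set u := of_x v; rewrite /of_q -/u /of_z0; ring.
(* [G] is (p(z') - p(z_0 phi)) / m'. *)
pose G v := px v - m2 (py v) * of_x v ^+ N * g.[of_q v].
have rG v : cof (pz v) * geom (pz v ord0) (of_A v) * r v = mon a' (py v) * G v.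
  rewrite -mulrA mulrC [geom _ _ * _]mulrC -geomP mulrBl -mon_cof /of_A exprMn.
  have E := of_eqn v; rewrite mon_upd -/(of_q v) in E.
  have {}E : of_z0 v ^+ b ord0 * cof (pz v) = of_q v - 1 by rewrite E addrK.
  rewrite mulrAC E /G mulrBr [mon a' _ * px v]mulrC (equation v).
  have -> : mon a' (py v) * (m2 (py v) * of_x v ^+ N * g.[of_q v]) =
      1 - (1 - of_q v) * (1 + of_q v * f.[of_q v]) ^+ b ord0.
    by rewrite fgE !mulrA -mon_aN /of_q exprMn; ring.
  ring.
(* [s] is the explicit witness that z_0' times the divided difference of p is
   congruent to -b_0 modulo m. *)
pose s v := - (cof (pz v) * pz v ord0 * r1 v * \sum_(i < b ord0)
    pz v ord0 ^+ ((b ord0).-1 - i) *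
    \sum_(l < i) of_A v ^+ (i.-1 - l) * pz v ord0 ^+ l) +
    (b ord0)%:R * m1 (py v) * px v.
have sE v : cof (pz v) * geom (pz v ord0) (of_A v) * pz v ord0 =
    - (b ord0)%:R + mon a (py v) * s v.
  have -> : geom (pz v ord0) (of_A v) = (b ord0)%:R * pz v ord0 ^+ (b ord0).-1 -
     mon a (py v) * r1 v * \sum_(i < b ord0)
    pz v ord0 ^+ ((b ord0).-1 - i) *
    \sum_(l < i) of_A v ^+ (i.-1 - l) * pz v ord0 ^+ l.
    rewrite -rE big_distrr /= -sumrN.
    rewrite (_ : _%:R * _ = \sum_(i < b ord0) pz v ord0 ^+ (b ord0).-1); last first.
      by rewrite sumr_const card_ord mulr_natl.
    rewrite -big_split; apply: eq_bigr => i _ /=.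
    rewrite mulrCA [r v * _](_ : _ = pz v ord0 ^+ i - of_A v ^+ i); last first.
      by rewrite -[r v]opprB mulNr -subrXX opprB.
    rewrite mulrBr opprB addrC.
    have le_ib : (i <= (b ord0).-1)%N by rewrite -ltnS prednK.
    by rewrite -exprD subnK ?subrK.
  have : cof (pz v) * (pz v ord0 * pz v ord0 ^+ (b ord0).-1) =
      mon a (py v) * m1 (py v) * px v - 1.
    by rewrite -exprS prednK // mulrC -mon_cof -mon_a' mulrC (equation v) addrK.
  rewrite /s; set T := (\sum_(i < _) _); set P := _ ^+ _; set Z := pz v ord0.
  move=> E; rewrite mulrBr mulrBl.
  have -> : cof (pz v) * ((b ord0)%:R * P) * Z = (b ord0)%:R * (cof (pz v) * (Z * P)).
    by ring.
  by rewrite E; ring.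
have bK := natK_neq0 charK (b_gt0 ord0).
pose e v := s v / (b ord0)%:R; pose h v := - (G v * pz v ord0 / (b ord0)%:R).
have step v : r v = mon a (py v) * e v * r v + mon a' (py v) * h v.
  apply: (mulfI bK); rewrite /e /h.
  have : (- (b ord0)%:R + mon a (py v) * s v) * r v = mon a' (py v) * G v * pz v ord0.
    by rewrite -sE -rG; ring.
  rewrite mulrDl mulNr => E.
  have -> : (b ord0)%:R * r v = mon a (py v) * s v * r v - mon a' (py v) * G v * pz v ord0.
    by rewrite -E opprD opprK addrCA subrr addr0.
  by field.
have regr : regular_fun r.
  by rewrite /r /of_A /of_q /of_x /of_z0 /geom /m1 /cof; reg.
have regh : regular_fun h.
  by rewrite /h /G /of_q /of_x /of_z0 /geom /m1 /m2 /cof; reg.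
have rege : regular_fun e.
  by rewrite /e /s /r1 /of_A /of_q /of_x /of_z0 /geom /m1 /m2 /cof; reg.
have iter j : {hj : point Y -> K | regular_fun hj &
    forall v, r v = (mon a (py v)) ^+ j * (e v ^+ j * r v) + mon a' (py v) * hj v}.
  elim: j => [|j [hj reghj IH]].
    by exists (fun=> 0) => [|v]; [reg | rewrite !expr0 !mul1r mulr0 addr0].
  exists (fun v => (mon a (py v)) ^+ j * e v ^+ j * h v + hj v) => [|v]; first by reg.
  by rewrite {1}IH {1}step !exprS; ring.
have [hN reghN E] := iter N.
exists (fun v => m2 (py v) * (e v ^+ N * r v) + hN v) => [|v].
  by rewrite /m2; reg.
by rewrite -/(r v) [in RHS]E mon_aN; ring.
Qed.

End FromFun.

(** Where y has no zero, the two maps are inverse to each other because m and m' can be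
    cancelled in the defining relations; [density] does the rest. *)
Lemma danielewski_inverse (h : point Y -> K) :
  regular_fun h -> (forall v, mon a' (py v) * h v = pz v ord0 - of_A v) ->
  let psi v := mkpt (h v) (of_eqn v) in
  [/\ cancel danielewski_fun psi, cancel psi danielewski_fun & regular_map psi].
Proof.
move=> reg_h hE psi.
have a'_gt0 j : (0 < a' j)%N by apply: leq_trans (le_aa' j).
have reg_psi : regular_map psi.
  apply: regmap_variety => [|j|j|].
  - apply: (@reg_ext _ _ of_x) => [v|]; rewrite ?mkptE //.
    by rewrite /of_x /geom /of_z0 /m1 /cof; reg.
  - by apply: (@reg_ext _ Y (fun v => py v j)) => [v|]; rewrite ?mkptE //; reg.
  - apply: (@reg_ext _ _ (fun v => upd (pz v) (of_z0 v) j)) => [v|].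
      by rewrite mkptE.
    by rewrite /upd; case: eqP => _; rewrite /of_z0; reg.
  - by apply: (@reg_ext _ _ h) => [v|]; rewrite ?mkptE.
split=> // v.
- apply: (regmap_density charK a_gt0 b_gt0 v (regmap_comp danielewski_regular reg_psi)).
    exact: regmap_id.
  move=> {}v [y0 z0 w0]; have ma0 := mon_neq0 a y0; have ma'0 := mon_neq0 a' y0.
  have yE : py (danielewski_fun v) =1 py v by move=> j; rewrite mkptE.
  have zE : of_z0 (danielewski_fun v) = pz v ord0.
    by rewrite /of_z0 (eq_mon _ yE) !mkptE to_wE /upd eqxx addrC subrK.
  have zzE : upd (pz (danielewski_fun v)) (of_z0 (danielewski_fun v)) =1 pz v.
    by move=> j; rewrite /upd; case: eqP => [->|/eqP/negbTE ne]; rewrite ?zE ?mkptE // /upd ne.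
  have xE : of_x (danielewski_fun v) = px v.
    apply: (mulIf ma0); rewrite -{1}(eq_mon a yE) of_eqn (eq_mon b zzE).
    by rewrite (equation v).
  apply: point_ext => [|j|j|]; rewrite !mkptE ?zzE //.
  apply: (mulfI ma'0); rewrite -{1}(eq_mon a' yE) hE !mkptE /upd eqxx.
  by rewrite /of_A /of_q xE zE (eq_mon a yE) -/(to_q v) -/(to_A v) /to_z0 addrC addKr.
- apply: (regmap_density charK a'_gt0 b_gt0 v (regmap_comp reg_psi danielewski_regular)).
    exact: regmap_id.
  move=> {}v [y0 z0 w0]; have ma0 := mon_neq0 a y0; have ma'0 := mon_neq0 a' y0.
  have yE : py (psi v) =1 py v by move=> j; rewrite mkptE.
  have zE : to_z0 (psi v) = pz v ord0.
    rewrite /to_z0 /to_A /to_q (eq_mon a yE) (eq_mon a' yE) !mkptE hE /upd eqxx.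
    by rewrite -/(of_q v) -/(of_A v) addrC subrK.
  have zzE : upd (pz (psi v)) (to_z0 (psi v)) =1 pz v.
    by move=> j; rewrite /upd; case: eqP => [->|/eqP/negbTE ne]; rewrite ?zE ?mkptE // /upd ne.
  apply: point_ext => [|j|j|]; rewrite !mkptE ?zzE //.
    apply: (mulIf ma'0); rewrite -{1}(eq_mon a' yE) to_eqn (eq_mon b zzE).
    by rewrite (equation v).
  apply: (mulfI ma0); rewrite -{1}(eq_mon a yE) to_wE zE mkptE /upd eqxx.
  by rewrite /of_z0 addrC addKr.
Qed.
End Danielewski.

(** Kept in [Type]: the sequence of tori is built from one isomorphism for each
    index. *)
Definition isomorphism (K : fieldType) (X Y : affset K) : Type :=
  {phi : point X -> point Y & {psi : point Y -> point X |
    [/\ cancel phi psi, cancel psi phi, regular_map phi & regular_map psi]}}.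

Lemma danielewski (K : closedFieldType) (charK : [pchar K] =i pred0) (k n : nat)
    (a a' : 'I_k -> nat) (b : 'I_n.+1 -> nat) (N : nat) :
  (forall j, 0 < a j)%N -> (forall j, 0 < b j)%N -> (0 < N)%N ->
  (forall j, a j <= a' j)%N -> (forall j, a' j <= N * a j)%N ->
  isomorphism (variety K a b) (variety K a' b).
Proof.
move=> a0 b0 N0 aa' a'N.
have /sigW[[f g] /= /eqP fg] : exists p : {poly K} * {poly K},
    (1 - 'X) * (1 + 'X * p.1) ^+ b ord0 == 1 - 'X ^+ N * p.2.
  by have [f [g fg]] := truncated_root charK (b0 ord0) N0; exists (f, g); apply/eqP.
have [h reg_h hE] := inverse_w_regular charK b0 aa' a'N fg.
have [H1 H2 H3] := danielewski_inverse charK a0 b0 aa' a'N fg reg_h hE.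
by do 2 eexists; split; [exact: H1 | exact: H2 | exact: danielewski_regular | exact: H3].
Defined.

(** * Pulling tori back, and an invariant of conjugacy *)

Section Transport.
Variables (K : fieldType) (X Y : affset K).
Variables (phi : point X -> point Y) (psi : point Y -> point X).
Hypotheses (phiK : cancel phi psi) (psiK : cancel psi phi).
Hypotheses (rphi : regular_map phi) (rpsi : regular_map psi).

Section Push.
Variable f : aut X.
Definition push_fun v := phi (f (psi v)).
Definition push_inv v := phi (aut_ifun f (psi v)).
Lemma push_funK : cancel push_fun push_inv.
Proof. by move=> v; rewrite /push_inv phiK aut_funK psiK. Qed.
Lemma push_invK : cancel push_inv push_fun.
Proof. by move=> v; rewrite /push_fun phiK aut_ifunK psiK. Qed.
Lemma push_regular : regular_map push_fun.
Proof. by apply: (regmap_comp _ rphi); apply: (regmap_comp rpsi); apply: aut_regular. Qed.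
Lemma push_iregular : regular_map push_inv.
Proof. by apply: (regmap_comp _ rphi); apply: (regmap_comp rpsi); apply: aut_iregular. Qed.
Definition push : aut Y := Aut push_funK push_invK push_regular push_iregular.
End Push.

Definition pull (S : aut Y -> Prop) (f : aut X) : Prop := S (push f).

End Transport.

Lemma torus_ext (K : fieldType) (X : affset K) d (T : aut X -> Prop) (f g : aut X) :
  is_torus d T -> f =1 g -> T f -> T g.
Proof.
move=> [G [rho [[_ _ _ TE] _]]] fg /TE[x fx]; apply/TE; exists x => v.
by rewrite -fg fx.
Qed.

(** The same algebraic group acts, through the conjugated automorphisms. *)
Lemma pull_torus (K : fieldType) (X Y : affset K) (phi : point X -> point Y)
    (psi : point Y -> point X) (phiK : cancel phi psi) (psiK : cancel psi phi)
    (rphi : regular_map phi) (rpsi : regular_map psi) d (S : aut Y -> Prop) :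
  is_torus d S -> is_torus d (pull phiK psiK rphi rpsi S).
Proof.
move=> [G [rho [[rhoM rhoI rhoR SE] isoG]]].
exists G, (fun g => push psiK phiK rpsi rphi (rho g)); split=> //; split.
- by move=> g h v; rewrite /= /push_fun psiK rhoM.
- move=> g h gh; apply: rhoI => v; have := gh (psi v).
  by move=> /(can_inj psiK); rewrite psiK.
- pose P := affprod G X; pose Q := affprod G Y.
  have onQ (u : point P) : @on_affset K Q [ffun i => match split i with
      inl j => proj1p u j | inr j => phi (proj2p u) j end].
    apply/allP => p; rewrite mem_cat => /orP[] /mapP[q qG ->];
      rewrite comp_mpoly_meval.
      have /allP/(_ q qG)/eqP qu := coordP (proj1p u); apply/eqP; rewrite -[RHS]qu.
      apply: meval_eq => i; rewrite tnth_mktuple mevalXU [LHS]ffunE.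
      by rewrite -[lshift _ _]/(unsplit (inl i)) unsplitK.
    have /allP/(_ q qG)/eqP qu := coordP (phi (proj2p u)); apply/eqP; rewrite -[RHS]qu.
    apply: meval_eq => i; rewrite tnth_mktuple mevalXU [LHS]ffunE.
    by rewrite -[rshift _ _]/(unsplit (inr i)) unsplitK.
  pose q (u : point P) : point Q := Point _ (onQ u).
  have q1 u : proj1p (q u) = proj1p u.
    apply/val_inj/ffunP => i; rewrite ffunE [LHS]ffunE.
    by rewrite -[lshift _ _]/(unsplit (inl i)) unsplitK.
  have q2 u : proj2p (q u) = phi (proj2p u).
    apply/val_inj/ffunP => i; rewrite ffunE [LHS]ffunE.
    by rewrite -[rshift _ _]/(unsplit (inr i)) unsplitK.
  have rq : regular_map q.
    move=> i; rewrite -(splitK i); case: (split i) => j /=.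
      apply: (@reg_ext _ P (fun u => proj1p u j)) => [u|]; last exact: reg_proj1.
      by rewrite [RHS]ffunE -[lshift _ _]/(unsplit (inl j)) unsplitK.
    apply: (@reg_ext _ P (fun u => phi (proj2p u) j)) => [u|].
      by rewrite [RHS]ffunE -[rshift _ _]/(unsplit (inr j)) unsplitK.
    by apply: reg_comp (rphi j); apply: reg_proj2.
  have H := regmap_comp (regmap_comp rq rhoR) rpsi.
  by move=> i; apply: reg_ext (H i) => u; rewrite q1 q2.
- move=> f; split=> [/SE[g fg]|[g fg]].
    by exists g => v; rewrite /= /push_fun -fg /= /push_fun !phiK.
  by apply/SE; exists g => v; rewrite /= /push_fun fg /= /push_fun !psiK.
Qed.

Lemma pull_maximal_torus (K : fieldType) (X Y : affset K)
    (phi : point X -> point Y)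
    (psi : point Y -> point X) (phiK : cancel phi psi) (psiK : cancel psi phi)
    (rphi : regular_map phi) (rpsi : regular_map psi) d (S : aut Y -> Prop) :
  is_maximal_torus d S -> is_maximal_torus d (pull phiK psiK rphi rpsi S).
Proof.
move=> [tS maxS]; split; first exact: pull_torus.
move=> d' T' tT' ST' f T'f; rewrite /pull.
apply: (maxS d' (pull psiK phiK rpsi rphi T')) => [|h Sh|].
- exact: pull_torus.
- apply: ST'; rewrite /pull; apply: (torus_ext tS) Sh => v.
  by rewrite /= /push_fun /= /push_fun !psiK.
- by apply: (torus_ext tT') T'f => v; rewrite /= /push_fun /= /push_fun !phiK.
Qed.

(** There is a point whose stabilizer in T has finite exponent, not dividing L.
    Within a torus, finite exponent means finite; stating it with iterates
    avoids any reference to the group structure of T. *)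
Definition stabilizer_exponent_ndvd (K : fieldType) (X : affset K) (L : nat)
    (T : aut X -> Prop) : Prop :=
  exists v, (exists2 M, (0 < M)%N & forall f, T f -> f v = v -> iter M f =1 id) /\
    exists2 f, T f & f v = v /\ ~ iter L f =1 id.

(** Stabilizers are carried to stabilizers by a bijection intertwining the elements of
    T with those of S. Both the passage between isomorphic varieties and
    conjugation are of this kind. *)
Lemma stabilizer_exponent_transfer (K : fieldType) (X Y : affset K)
    (phi : point X -> point Y) (psi : point Y -> point X) L
    (T : aut X -> Prop) (S : aut Y -> Prop) :
  cancel phi psi -> cancel psi phi ->
  (forall f, T f -> exists2 h, S h & forall v, h (phi v) = phi (f v)) ->
  (forall h, S h -> exists2 f, T f & forall v, h (phi v) = phi (f v)) ->
  stabilizer_exponent_ndvd L T -> stabilizer_exponent_ndvd L S.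
Proof.
move=> phiK psiK TS ST [v [[M M0 kM] [f Tf [fv nL]]]].
have it h f' m : (forall u, h (phi u) = phi (f' u)) ->
    forall u, iter m h (phi u) = phi (iter m f' u).
  by move=> hf u; elim: m => //= m ->; rewrite hf.
exists (phi v); split.
  exists M => // h /ST[f' Tf' hf'] hv u; rewrite -[u]psiK (it _ _ _ hf').
  by rewrite kM //; apply: (can_inj phiK); rewrite -hf'.
have [h Sh hf] := TS f Tf; exists h => //; split; first by rewrite hf fv.
move=> hL; apply: nL => u; apply: (can_inj phiK).
by rewrite -(it _ _ _ hf) hL.
Qed.

Lemma stabilizer_exponent_pull (K : fieldType) (X Y : affset K)
    (phi : point X -> point Y)
    (psi : point Y -> point X) (phiK : cancel phi psi) (psiK : cancel psi phi)
    (rphi : regular_map phi) (rpsi : regular_map psi) d L (S : aut Y -> Prop) :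
  is_torus d S ->
  stabilizer_exponent_ndvd L (pull phiK psiK rphi rpsi S) <->
  stabilizer_exponent_ndvd L S.
Proof.
move=> tS.
have E1 h : S h -> pull phiK psiK rphi rpsi S (push psiK phiK rpsi rphi h).
  by move=> Sh; apply: (torus_ext tS) Sh => v; rewrite /= /push_fun /= /push_fun !psiK.
split.
  apply: (stabilizer_exponent_transfer phiK psiK) => [f Tf|h Sh].
    by exists (push phiK psiK rphi rpsi f) => // v; rewrite /= /push_fun phiK.
  exists (push psiK phiK rpsi rphi h); first exact: E1.
  by move=> v; rewrite /= /push_fun psiK.
apply: (stabilizer_exponent_transfer psiK phiK) => [h Sh|f Tf].
  exists (push psiK phiK rpsi rphi h); first exact: E1.
  by move=> v; rewrite /= /push_fun psiK.
by exists (push phiK psiK rphi rpsi f) => // v; rewrite /= /push_fun phiK.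
Qed.

Lemma stabilizer_exponent_conjugate (K : fieldType) (X : affset K) L
    (T T' : aut X -> Prop) :
  conjugate T T' ->
  stabilizer_exponent_ndvd L T <-> stabilizer_exponent_ndvd L T'.
Proof.
move=> [g gT].
have E f : T f -> exists2 h, T' h & forall v, h (g v) = g (f v).
  move=> Tf; exists (push (aut_funK g) (aut_ifunK g) (aut_regular g) (aut_iregular g) f).
    by apply/gT; exists f.
  by move=> v; rewrite /= /push_fun aut_funK.
have E' h : T' h -> exists2 f, T f & forall v, h (g v) = g (f v).
  by move=> /gT[f Tf hf]; exists f => // v; rewrite hf /= aut_funK.
split.
  exact: (stabilizer_exponent_transfer (aut_funK g) (aut_ifunK g)).
apply: (stabilizer_exponent_transfer (aut_ifunK g) (aut_funK g)) => [h T'h|f Tf].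
  have [f Tf hf] := E' h T'h; exists f => // v.
  by rewrite -{2}[v](aut_ifunK g) hf aut_funK.
have [h T'h hf] := E f Tf; exists h => // v.
by rewrite -{2}[v](aut_ifunK g) hf aut_funK.
Qed.

(** * A diagonal torus *)

(** d is the gcd of b and beta = b / d is a primitive vector, completed to a
    unimodular matrix. All this is the Smith normal form of the row b, up to the
    sign e that makes the first row of M positive. *)
Lemma primitive_row (n : nat) (b : 'I_n.+1 -> nat) : (forall j, 0 < b j)%N ->
  exists (d : nat) (beta : 'I_n.+1 -> nat) (M M' : 'M[int]_n.+1),
    [/\ M *m M' = 1%:M, M' *m M = 1%:M, forall j, M ord0 j = (beta j)%:Z
      & forall j, b j = (d * beta j)%N].
Proof.
move=> b0; have [L _ [M uM [d _ b_eq]]] :=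
  int_Smith_normal_form (\row_j (b j)%:Z : 'rV[int]_n.+1).
pose c := L ord0 ord0 * d`_0.
have cE j : (b j)%:Z = c * M ord0 j.
  have := congr1 (fun B : 'rV[int]_n.+1 => B ord0 j) b_eq; rewrite mxE => ->.
  rewrite mxE (bigD1 ord0) //= big1 ?addr0 => [|i /negbTE ne]; last first.
    rewrite !mxE big_ord_recl big_ord0 addr0 mxE.
    case E: (_ == _ :> nat); last by rewrite mulr0n mulr0 mul0r.
    by move: ne; rewrite -val_eqE /= eq_sym E.
  by rewrite !mxE big_ord_recl big_ord0 addr0 mxE eqxx mulr1n.
pose e : int := if 0 <= c then 1 else -1.
have ee : e * e = 1 by rewrite /e; case: ifP.
have ce : c * e = `|c|%N%:Z.
  rewrite /e; case: ifP => [/gez0_abs|/negbT]; first by rewrite mulr1.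
  by rewrite -ltNge => /ltz0_abs; rewrite mulrN1.
have Mpos j : e * M ord0 j = `|M ord0 j|%N%:Z.
  have: 0 < c * M ord0 j by rewrite -cE ltz_nat.
  rewrite /e; case: ifP; case: (ltrgt0P (M ord0 j)); nia.
exists `|c|%N, (fun j => `|M ord0 j|%N), (e *: M), (e *: invmx M); split.
- by rewrite -scalemxAl -scalemxAr scalerA ee scale1r mulmxV.
- by rewrite -scalemxAl -scalemxAr scalerA ee scale1r mulVmx.
- by move=> j; rewrite mxE.
move=> j; apply/eqP; rewrite -eqz_nat PoszM -ce -Mpos cE.
by rewrite -mulrA [e * (e * _)]mulrA ee mul1r.
Qed.

Section MonomialMap.
Variables (K : fieldType) (m : nat).
Implicit Types (M : 'M[int]_m) (s : 'I_m -> K).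

(** The endomorphism of a split torus given by an integer matrix. *)
Definition monmap M s (i : 'I_m) : K := \prod_j s j ^ M i j.

Lemma monmap_neq0 M s : (forall i, s i != 0) -> forall i, monmap M s i != 0.
Proof. by move=> s0 i; apply/prodf_neq0 => j _; rewrite expfz_neq0. Qed.

Lemma monmap_prod M s s' : (forall i, s i != 0) -> (forall i, s' i != 0) ->
  forall i, monmap M (fun j => s j * s' j) i = monmap M s i * monmap M s' i.
Proof.
by move=> s0 s'0 i; rewrite -big_split; apply: eq_bigr => j _; rewrite expfzMl.
Qed.

Lemma prod_exprz (I : Type) (r : seq I) (P : pred I) (F : I -> int) (x : K) :
  x != 0 -> \prod_(i <- r | P i) x ^ F i = x ^ (\sum_(i <- r | P i) F i).
Proof.
move=> x0; elim: r => [|i r IH]; rewrite ?big_nil ?expr0z // !big_cons.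
by case: (P i); rewrite IH // expfzDr.
Qed.

Lemma monmap_comp M M' s : (forall i, s i != 0) ->
  monmap M (monmap M' s) =1 monmap (M *m M') s.
Proof.
move=> s0 i; rewrite /monmap.
have E j : (\prod_l s l ^ M' j l) ^ M i j = \prod_l s l ^ (M i j * M' j l).
  rewrite (big_morph (fun x => x ^ M i j) (fun x y => expfzMl x y _) (exp1rz _ _)).
  by apply: eq_bigr => l _; rewrite exprz_exp mulrC.
under eq_bigr => j _ do rewrite E.
rewrite exchange_big /=; apply: eq_bigr => l _; rewrite prod_exprz // mxE.
exact: erefl.
Qed.

Lemma monmap1 s : monmap 1%:M s =1 s.
Proof.
move=> i; rewrite /monmap (bigD1 i) //= mxE eqxx big1 ?mulr1 // => j /negbTE ne.
by rewrite mxE eq_sym ne.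
Qed.

Lemma eq_monmap M s s' : s =1 s' -> monmap M s =1 monmap M s'.
Proof. by move=> ss i; apply: eq_bigr => j _; rewrite ss. Qed.

End MonomialMap.

Section GmPoints.
Variables (K : fieldType) (D : nat).
Local Notation G := (point (Gm_set K D)).
Implicit Types g h : G.

Definition gc g (i : 'I_D) : K := g (lshift D i).
Definition gi g (i : 'I_D) : K := g (rshift D i).

Lemma gcK g i : gc g i * gi g i = 1.
Proof. by have /Gm_setP/(_ i) := coordP g. Qed.
Lemma gc_neq0 g i : gc g i != 0.
Proof. by apply: contra_eq_neq (gcK g i) => ->; rewrite mul0r eq_sym oner_eq0. Qed.
Lemma giE g i : gi g i = (gc g i)^-1.
Proof. by apply: (mulfI (gc_neq0 g i)); rewrite gcK mulfV ?gc_neq0. Qed.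
Lemma gcM g h i : gc (Gm_mul g h) i = gc g i * gc h i.
Proof. by rewrite /gc ffunE. Qed.
Lemma gc1 i : gc (Gm_one K D) i = 1. Proof. by rewrite /gc ffunE. Qed.

Lemma Gm_ext g h : gc g =1 gc h -> g = h.
Proof.
move=> gh; apply/val_inj/ffunP => i; rewrite -(splitK i).
case: (split i) => j /=; first exact: gh.
by rewrite -[LHS]/(gi g j) -[RHS]/(gi h j) !giE gh.
Qed.

Lemma mkGm_on (c : 'I_D -> K) : (forall i, c i != 0) ->
  on_affset (Gm_set K D)
    [ffun i => match split i with inl j => c j | inr j => (c j)^-1 end].
Proof.
move=> c0; apply/Gm_setP => i; rewrite !ffunE.
rewrite -[lshift D i]/(unsplit (inl i)) -[rshift D i]/(unsplit (inr i)) !unsplitK.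
by rewrite mulfV.
Qed.

Lemma mkGm (c : 'I_D -> K) : (forall i, c i != 0) -> exists g, gc g =1 c.
Proof.
move=> c0; exists (@Point K (Gm_set K D) _ (mkGm_on c0)) => i.
by rewrite /gc /= ffunE -[lshift D i]/(unsplit (inl i)) unsplitK.
Qed.

Lemma reg_gc i : regular_fun (fun g => gc g i). Proof. exact: reg_coord. Qed.
Lemma reg_gi i : regular_fun (fun g => gi g i). Proof. exact: reg_coord. Qed.
Lemma reg_gcz i (e : int) : regular_fun (fun g => gc g i ^ e).
Proof.
case: e => e; first by apply: reg_exp; apply: reg_gc.
apply: (@reg_ext _ _ (fun g => gi g i ^+ e.+1)) => [g|].
  by rewrite giE exprVn.
by apply: reg_exp; apply: reg_gi.
Qed.

End GmPoints.

Section Torus.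
Variables (K : closedFieldType) (k n : nat).
Variables (a : 'I_k -> nat) (b : 'I_n.+1 -> nat).
Variables (d : nat) (beta : 'I_n.+1 -> nat) (M M' : 'M[int]_n.+1).
Hypotheses (charK : [pchar K] =i pred0).
Hypotheses (a_gt0 : forall j, (0 < a j)%N) (b_gt0 : forall j, (0 < b j)%N).
Hypotheses (MM' : M *m M' = 1%:M) (M'M : M' *m M = 1%:M).
Hypotheses (M0 : forall j, M ord0 j = (beta j)%:Z)
  (b_eq : forall j, b j = (d * beta j)%N).

Lemma beta_gt0 j : (0 < beta j)%N.
Proof. by have := b_gt0 j; rewrite b_eq muln_gt0 => /andP[]. Qed.

Lemma d_gt0 : (0 < d)%N.
Proof. by have := b_gt0 ord0; rewrite b_eq muln_gt0 => /andP[]. Qed.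
Local Notation V := (variety K a b).
Local Notation D := (k + n.+1)%N.
Local Notation G := (point (Gm_set K D)).

(** Coordinates of the torus of dimension k + n + 1: the first k scale y, the
    next one scales w, and the last n are the coordinates sigma_1, ..., sigma_n
    on the subtorus s^beta = 1 of the scalings of z. Completing sigma by
    sigma_0 = 1, the subtorus is parametrized by the monomial map of M', the inverse of
    M, since the row 0 of M is beta. *)
Definition tpart (g : G) (j : 'I_k) : K := gc g (lshift n.+1 j).
Definition opart (g : G) : K := gc g (rshift k ord0).
Definition sigma (g : G) (i : 'I_n.+1) : K :=
  if i == ord0 then 1 else gc g (rshift k i).
Definition spart (g : G) : 'I_n.+1 -> K := monmap M' (sigma g).

Lemma tpart_neq0 g j : tpart g j != 0. Proof. exact: gc_neq0. Qed.
Lemma sigma_neq0 g i : sigma g i != 0.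
Proof. by rewrite /sigma; case: (i =P ord0) => _; rewrite ?oner_eq0 ?gc_neq0. Qed.

Lemma monmap_ord0 (s : _ -> K) : monmap M s ord0 = mon beta s.
Proof. by apply: eq_bigr => j _; rewrite M0. Qed.

Lemma mon_b (s : 'I_n.+1 -> K) : mon b s = mon beta s ^+ d.
Proof. by rewrite -prodrXl; apply: eq_bigr => j _; rewrite b_eq mulnC exprM. Qed.

Lemma monmap_spart g : monmap M (spart g) =1 sigma g.
Proof.
move=> i; rewrite monmap_comp; last exact: sigma_neq0.
by rewrite MM' monmap1.
Qed.

Lemma mon_spart g : mon beta (spart g) = 1.
Proof. by rewrite -monmap_ord0 monmap_spart /sigma eqxx. Qed.

(** The monomial map of M recovers sigma from s. *)
Lemma torus_point (t : 'I_k -> K) (s : 'I_n.+1 -> K) (o : K) :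
  (forall j, t j != 0) -> (forall j, s j != 0) -> o != 0 -> mon beta s = 1 ->
  exists g, [/\ tpart g =1 t, spart g =1 s & opart g = o].
Proof.
move=> t0 s0 o0 s1.
pose c (i : 'I_D) := match split i with
  | inl j => t j | inr j => if j == ord0 then o else monmap M s j end.
have [i|g gE] := @mkGm K D c.
  rewrite /c; case: (split i) => j //; case: (j =P ord0) => // _.
  exact: monmap_neq0.
exists g; split=> [j|j|].
- by rewrite /tpart gE /c -[lshift _ _]/(unsplit (inl j)) unsplitK.
- rewrite /spart; have sE : sigma g =1 monmap M s.
    move=> i; rewrite /sigma gE /c -[rshift _ _]/(unsplit (inr i)) unsplitK.
    by case: eqP => // ->; rewrite monmap_ord0 s1.
  by rewrite (eq_monmap M' sE) monmap_comp // M'M monmap1.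
- by rewrite /opart gE /c -[rshift _ _]/(unsplit (inr ord0)) unsplitK eqxx.
Qed.

Lemma tpartM g h j : tpart (Gm_mul g h) j = tpart g j * tpart h j.
Proof. exact: gcM. Qed.
Lemma opartM g h : opart (Gm_mul g h) = opart g * opart h.
Proof. exact: gcM. Qed.
Lemma spartM g h j : spart (Gm_mul g h) j = spart g j * spart h j.
Proof.
rewrite -monmap_prod; try exact: sigma_neq0.
by apply: eq_monmap => i; rewrite /sigma; case: eqP; rewrite ?mulr1 ?gcM.
Qed.

Lemma parts_inj g h : tpart g =1 tpart h -> spart g =1 spart h ->
  opart g = opart h -> g = h.
Proof.
move=> et es eo; apply: Gm_ext => i; rewrite -(splitK i).
case: (split i) => j /=; first exact: et.
have [->|/negbTE ne] := eqVneq j ord0; first exact: eo.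
have : sigma g j = sigma h j by rewrite -!monmap_spart (eq_monmap M es).
by rewrite /sigma ne.
Qed.

Lemma act_eqn (g : G) (v : point V) :
  mon a (fun j => (tpart g j)^-1) * px v * mon a (fun j => tpart g j * py v j) =
  mon b (fun j => spart g j * pz v j) + 1.
Proof.
rewrite !monM mon_b mon_spart expr1n mul1r -(equation v) mulrACA -monM.
rewrite (eq_mon _ (y' := fun=> 1)) ?mon1 ?mul1r // => j.
by rewrite mulVf // tpart_neq0.
Qed.

Definition act (g : G) (v : point V) : point V :=
  mkpt (opart g * pw v) (act_eqn g v).

Lemma act_px g v : px (act g v) = mon a (fun j => (tpart g j)^-1) * px v.
Proof. by rewrite mkptE. Qed.
Lemma act_py g v j : py (act g v) j = tpart g j * py v j.
Proof. by rewrite mkptE. Qed.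
Lemma act_pz g v j : pz (act g v) j = spart g j * pz v j.
Proof. by rewrite mkptE. Qed.
Lemma act_pw g v : pw (act g v) = opart g * pw v.
Proof. by rewrite mkptE. Qed.
Definition actE := (act_px, act_py, act_pz, act_pw).

Lemma actM g h v : act (Gm_mul g h) v = act g (act h v).
Proof.
apply: point_ext => [|j|j|]; rewrite !actE ?tpartM ?spartM ?opartM ?mulrA //.
congr (_ * _); rewrite -monM; apply: eq_mon => j.
by rewrite tpartM invfM.
Qed.

Lemma parts1 : [/\ tpart (Gm_one K D) =1 (fun=> 1), spart (Gm_one K D) =1 (fun=> 1)
  & opart (Gm_one K D) = 1].
Proof.
split=> [j|j|]; rewrite /tpart /opart ?gc1 // /spart /monmap.
apply: big1 => i _.
by rewrite /sigma gc1; case: eqP => _; rewrite exp1rz.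
Qed.

Lemma act1 v : act (Gm_one K D) v = v.
Proof.
have [t1 s1 o1] := parts1.
apply: point_ext => [|j|j|]; rewrite !actE ?t1 ?s1 ?o1 ?mul1r //.
rewrite (eq_mon _ (y' := fun=> 1)) ?mon1 ?mul1r // => j.
by rewrite t1 invr1.
Qed.

Lemma reg_act : regular_map
  (fun u : point (affprod (Gm_set K D) V) => act (proj1p u) (proj2p u)).
Proof.
pose P := affprod (Gm_set K D) V.
have R1 (F : G -> K) : regular_fun F -> regular_fun (fun u : point P => F (proj1p u)).
  by move=> rF; apply: reg_comp rF; apply: reg_proj1.
have R2 (F : point V -> K) : regular_fun F -> regular_fun (fun u : point P => F (proj2p u)).
  by move=> rF; apply: reg_comp rF; apply: reg_proj2.
apply: regmap_variety => [|j|j|].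
- apply: (@reg_ext _ P (fun u => mon a (fun j => gi (proj1p u) (lshift n.+1 j)) * px (proj2p u))).
    by move=> u; rewrite act_px; congr (_ * _); apply: eq_mon => j; rewrite giE.
  apply: reg_mul; last by apply: R2; reg.
  by apply: reg_mon => j; apply: (R1 (fun g => gi g _)); apply: reg_gi.
- apply: (@reg_ext _ P (fun u => tpart (proj1p u) j * py (proj2p u) j)).
    by move=> u; rewrite act_py.
  apply: reg_mul; last by apply: (R2 (fun v => py v j)); reg.
  by apply: (R1 (fun g => tpart g j)); apply: reg_gc.
- apply: (@reg_ext _ P (fun u => spart (proj1p u) j * pz (proj2p u) j)).
    by move=> u; rewrite act_pz.
  apply: reg_mul; last by apply: (R2 (fun v => pz v j)); reg.
  apply: (R1 (fun g => spart g j)); apply: reg_prod => i.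
  rewrite /sigma; case: eqP => _; last exact: reg_gcz.
  by apply: (@reg_ext _ _ (fun=> 1)) => [u|]; rewrite ?exp1rz //; apply: reg_const.
- apply: (@reg_ext _ P (fun u => opart (proj1p u) * pw (proj2p u))).
    by move=> u; rewrite act_pw.
  apply: reg_mul; last by apply: R2; reg.
  by apply: (R1 (fun g => opart g)); apply: reg_gc.
Qed.

Lemma actK g : cancel (act g) (act (Gm_inv g)).
Proof. by move=> v; rewrite -actM Gm_mulV act1. Qed.

Lemma Gm_mulC (m : nat) (g h : point (Gm_set K m)) : Gm_mul g h = Gm_mul h g.
Proof. by apply: Gm_ext => i; rewrite !gcM mulrC. Qed.

Lemma actVK g : cancel (act (Gm_inv g)) (act g).
Proof. by move=> v; rewrite -actM Gm_mulC Gm_mulV act1. Qed.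

Lemma act_regular g : regular_map (act g).
Proof.
apply: regmap_variety => [|j|j|].
- by apply: (@reg_ext _ V (fun v => mon a (fun j => (tpart g j)^-1) * px v)) => [v|];
    [rewrite act_px | reg].
- by apply: (@reg_ext _ V (fun v => tpart g j * py v j)) => [v|];
    [rewrite act_py | reg].
- by apply: (@reg_ext _ V (fun v => spart g j * pz v j)) => [v|];
    [rewrite act_pz | reg].
- by apply: (@reg_ext _ V (fun v => opart g * pw v)) => [v|];
    [rewrite act_pw | reg].
Qed.

Definition rho (g : G) : aut V :=
  Aut (actK g) (actVK g) (act_regular g) (act_regular (Gm_inv g)).

Definition torus (f : aut V) : Prop := exists g, f =1 rho g.

Lemma ones_eqn : (2%:R : K) * mon a (fun=> 1) = mon b (fun=> 1) + 1.
Proof. by rewrite !mon1 mulr1. Qed.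

Lemma torusP : is_torus D torus.
Proof.
exists (Gm K D), rho; split; last first.
  by exists id, id; split=> // i; apply: reg_coord.
split=> [g h v|g h gh||f].
- exact: actM.
- have gh1 := gh (mkpt 1 ones_eqn).
  apply: parts_inj => [j|j|].
  + by have := congr1 (fun v => py v j) gh1; rewrite /= !actE !mkptE !mulr1.
  + by have := congr1 (fun v => pz v j) gh1; rewrite /= !actE !mkptE !mulr1.
  + by have := congr1 (fun v => pw v) gh1; rewrite /= !actE !mkptE !mulr1.
- exact: reg_act.
- by [].
Qed.

Let units := {u : K | u != 0}.

(** u = z^beta generates the invariants of the torus. *)
Definition inv_u (v : point V) : K := mon beta (pz v).

(** A curve meeting almost every orbit once: y and w are 1, and z is a point with
    z^beta = u, whose coordinates are powers of u given by a column of M'. *)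
Definition slice_z (u : K) : 'I_n.+1 -> K :=
  monmap M' (fun i => if i == ord0 then u else 1).

Lemma slice_zE u j : slice_z u j = u ^ M' j ord0.
Proof.
rewrite /slice_z /monmap (bigD1 ord0) //= big1 ?mulr1 // => i /negbTE->.
exact: exp1rz.
Qed.

Lemma slice_eqn (u : units) : (val u ^+ d + 1) * mon a (fun=> 1) =
  mon b (slice_z (val u)) + 1.
Proof.
rewrite mon1 mulr1 mon_b -monmap_ord0 monmap_comp ?MM' ?monmap1 ?eqxx // => i.
by case: (i =P ord0) => _; rewrite ?oner_eq0 ?(valP u).
Qed.

Definition slice (u : units) : point V := mkpt 1 (slice_eqn u).

Lemma slice_u u : inv_u (slice u) = val u.
Proof.
rewrite /inv_u (eq_mon _ (pz_mkpt _ _)) -monmap_ord0 monmap_comp ?MM' ?monmap1 ?eqxx //.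
by move=> i; case: (i =P ord0) => _; rewrite ?oner_eq0 ?(valP u).
Qed.

Lemma slice_orbit v : generic v -> exists g u, val u = inv_u v /\ v = act g (slice u).
Proof.
move=> [y0 z0 w0]; have u0 : inv_u v != 0 by apply: mon_neq0.
pose u : units := exist _ (inv_u v) u0.
have sz0 j : pz (slice u) j != 0 by rewrite mkptE slice_zE expfz_neq0.
have [j||g [gt gs go]] := @torus_point (py v) (fun j => pz v j / pz (slice u) j) (pw v) y0 _ w0.
- by rewrite mulf_neq0 ?invr_eq0.
- apply: (mulIf (_ : inv_u (slice u) != 0)); first by rewrite slice_u.
  rewrite {1}/inv_u -monM mul1r slice_u /=; apply: eq_mon => j.
  by rewrite divfK.
exists g, u; split=> //.
have ey : py v =1 py (act g (slice u)) by move=> j; rewrite actE mkptE gt mulr1.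
have ez : pz v =1 pz (act g (slice u)) by move=> j; rewrite actE gs divfK.
apply: point_ext => //; last by rewrite actE mkptE go mulr1.
apply: (mulIf (mon_neq0 a y0)); rewrite [in RHS](eq_mon a ey).
by rewrite !equation (eq_mon b ez).
Qed.

(** Regular functions restrict to Laurent polynomials in u on the slice. The factor
    u^e serves to divide by a weight function. *)
Lemma slice_laurent (F : point V -> K) (e : int) : regular_fun F ->
  exists m (C : {poly K}), forall u : units, val u ^+ m * (val u ^ e * F (slice u)) = C.[val u].
Proof.
pose P (h : units -> K) := exists m (C : {poly K}), forall u : units, val u ^+ m * h u = C.[val u].
have Pext f h : f =1 h -> P f -> P h.
  by move=> fh [m [C E]]; exists m, C => u; rewrite -fh.
have Pc c : P (fun=> c).
  by exists 0%N, c%:P => u; rewrite mul1r hornerC.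
have Pd f h : P f -> P h -> P (fun u => f u + h u).
  move=> [m [C E]] [m' [C' E']]; exists (m + m')%N, ('X^m' * C + 'X^m * C') => u.
  by rewrite hornerD !hornerM !hornerXn -E -E' exprD; ring.
have Pm f h : P f -> P h -> P (fun u => f u * h u).
  move=> [m [C E]] [m' [C' E']]; exists (m + m')%N, (C * C') => u.
  by rewrite hornerM -E -E' exprD; ring.
have Pz z : P (fun u => val u ^ z).
  case: z => z; first by exists 0%N, 'X^z => u; rewrite mul1r hornerXn.
  by exists z.+1, 1 => u; rewrite hornerC mulfV // expf_neq0 ?(valP u).
move=> rF; apply: (Pm (fun u => val u ^ e) (F \o slice)) => //.
apply: (@meval_variety K k n a b units P slice) => //.
- apply: (Pext (fun u => val u ^ d%:Z + 1)) => [u|]; first by rewrite mkptE.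
  exact: Pd.
- by move=> j; apply: Pext (Pc 1) => u; rewrite mkptE.
- by move=> j; apply: Pext (Pz (M' j ord0)) => u; rewrite mkptE slice_zE.
- by apply: Pext (Pc 1) => u; rewrite mkptE.
Qed.

Lemma inv_u_neq0 v : generic v -> inv_u v != 0.
Proof. by move=> [_ z0 _]; apply: mon_neq0. Qed.

Lemma reg_inv_u : regular_fun inv_u.
Proof. by rewrite /inv_u; reg. Qed.

(** The weight functions Q used below are y_j, z_j, w and 1. The last condition is
    what allows a power of u to be cancelled from an equation u^m F = Q C(u). *)
Definition weight_fun (chi : G -> K) (e : int) (Q : point V -> K) :=
  [/\ regular_fun Q, forall g v, Q (act g v) = chi g * Q v,
     forall u, Q (slice u) = val u ^ e & exists2 v, inv_u v = 0 & Q v != 0].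

(** On generic points F is determined by its values on the slice, so
    F = Q C(u) / u^m there. If m > 0, then C(0) = 0 because Q does not vanish on all
    of u = 0, and u cancels. *)
Lemma semi_invariant chi e Q F : weight_fun chi e Q -> regular_fun F ->
  (forall g v, F (act g v) = chi g * F v) ->
  exists C : {poly K}, forall v, F v = Q v * C.[inv_u v].
Proof.
move=> [rQ Qg Qs [v0 u0 Q0]] rF Fg.
have [m [C CE]] := slice_laurent (- e) rF.
have rC (p : {poly K}) : regular_fun (fun v => Q v * p.[inv_u v]).
  by apply: reg_mul => //; apply: reg_poly; apply: reg_inv_u.
have rm l : regular_fun (fun v => inv_u v ^+ l * F v).
  by apply: reg_mul => //; apply: reg_exp; apply: reg_inv_u.
have: forall v, inv_u v ^+ m * F v = Q v * C.[inv_u v].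
  move=> v; apply: (density_eq charK a_gt0 b_gt0 v (rm m) (rC C)) => {}v vgen.
  have [g [u [uE vE]]] := slice_orbit vgen.
  rewrite -uE {1 2}vE Fg Qg Qs -CE mulrCA -!mulrA; congr (_ * _).
  rewrite [in RHS]mulrCA; congr (_ * _).
  by rewrite mulrA -expfzDr ?(valP u) // subrr expr0z mul1r.
elim: m C {CE} => [|m IH] C E; first by exists C => v; rewrite -E mul1r.
have /factor_theorem[C' C'E] : root C 0.
  have := E v0; rewrite u0 expr0n mul0r => /esym/eqP.
  by rewrite mulf_eq0 (negbTE Q0).
apply: (IH C') => v; apply: (density_eq charK a_gt0 b_gt0 v (rm m) (rC C')) => {}v vgen.
apply: (mulfI (inv_u_neq0 vgen)); rewrite mulrA -exprS E C'E subr0 hornerM hornerX.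
by rewrite mulrA mulrC.
Qed.

Lemma weight_py j : weight_fun (fun g => tpart g j) 0 (fun v => py v j).
Proof.
split; first by reg.
- by move=> g v; rewrite act_py.
- by move=> u; rewrite mkptE.
have e : 1 * mon a (fun=> 1) = mon b (fun=> 0 : K) + 1.
  by rewrite mon1 mulr1 (mon0 (b_gt0 ord0)) ?add0r.
exists (mkpt 1 e); last by rewrite mkptE oner_eq0.
by apply: (mon0 (beta_gt0 ord0)); rewrite mkptE.
Qed.

Lemma weight_pw : weight_fun opart 0 (@pw K k n a b).
Proof.
split; first by reg.
- by move=> g v; rewrite act_pw.
- by move=> u; rewrite mkptE.
have e : 1 * mon a (fun=> 1) = mon b (fun=> 0 : K) + 1.
  by rewrite mon1 mulr1 (mon0 (b_gt0 ord0)) ?add0r.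
exists (mkpt 1 e); last by rewrite mkptE oner_eq0.
by apply: (mon0 (beta_gt0 ord0)); rewrite mkptE.
Qed.

(** When n = 0 the coordinate z_0 is invariant and vanishes wherever u does: it is
    not a weight function, and is treated apart in [centralizer_diagonal]. *)
Lemma weight_pz j : (0 < n)%N ->
  weight_fun (fun g => spart g j) (M' j ord0) (fun v => pz v j).
Proof.
move=> n0; split; first by reg.
- by move=> g v; rewrite act_pz.
- by move=> u; rewrite mkptE slice_zE.
have [i ij] : exists i : 'I_n.+1, i != j.
  case: (eqVneq j ord0) => [->|j0]; last by exists ord0; rewrite eq_sym.
  by exists ord_max; rewrite -val_eqE /= -lt0n.
pose z l : K := (l == j)%:R; have zi : z i = 0 by rewrite /z (negbTE ij).
have e : 1 * mon a (fun=> 1) = mon b z + 1.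
  by rewrite mon1 mulr1 (mon0 (b_gt0 i)) ?add0r.
exists (mkpt 1 e); last by rewrite mkptE /z eqxx oner_eq0.
by apply: (mon0 (beta_gt0 i)); rewrite mkptE.
Qed.

Lemma weight_1 : weight_fun (fun=> 1) 0 (fun=> 1).
Proof.
have [_ _ _ [v v0 _]] := weight_pw.
split; first by reg.
- by move=> g u; rewrite mul1r.
- by [].
- by exists v => //; apply: oner_neq0.
Qed.

Lemma inv_u_act g v : inv_u (act g v) = inv_u v.
Proof. by rewrite /inv_u (eq_mon _ (act_pz g v)) monM mon_spart mul1r. Qed.

Lemma poly_eq_on_units (p q : {poly K}) : (forall u : units, p.[val u] = q.[val u]) -> p = q.
Proof.
move=> pq; apply/eqP; rewrite -subr_eq0; apply/eqP.
apply: (@poly_vanish_eq0 _ _ 'X); rewrite ?polyX_eq0 // => t; rewrite hornerX => t0.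
by rewrite hornerD hornerN (pq (exist _ t t0)) subrr.
Qed.

Section Centralizer.
Variables f fi : point V -> point V.
Hypotheses (rf : regular_map f) (rfi : regular_map fi).
Hypotheses (fK : cancel f fi) (fiK : cancel fi f).
Hypotheses (fC : forall g v, f (act g v) = act g (f v))
  (fiC : forall g v, fi (act g v) = act g (fi v)).

(** f and its inverse induce polynomials in u that are inverse to each other for
    composition, hence of degree 1. *)
Lemma inv_u_centralizer :
  exists2 B : {poly K}, size B = 2 & forall v, inv_u (f v) = B.[inv_u v].
Proof.
have H h : regular_map h -> (forall g v, h (act g v) = act g (h v)) ->
    exists B : {poly K}, forall v, inv_u (h v) = B.[inv_u v].
  move=> rh hC; have [g v|C CE] := semi_invariant weight_1 (reg_comp rh reg_inv_u).
    by rewrite hC inv_u_act mul1r.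
  by exists C => v; rewrite CE mul1r.
have [B BE] := H _ rf fC; have [Bi BiE] := H _ rfi fiC.
exists B => //; have : B \Po Bi = 'X.
  apply: poly_eq_on_units => u; rewrite horner_comp hornerX -slice_u -BiE -BE.
  by rewrite fiK.
move=> /(congr1 (fun p : {poly K} => (size p).-1)); rewrite size_comp_poly size_polyX /=.
by move/eqP; rewrite muln_eq1 => /andP[/eqP + _]; case: (size B) => // m /= ->.
Qed.

(** The pull-backs of Q by f and by its inverse are Q C(u) and Q Ci(u); composing them,
    C (Ci o B) = 1, where B is the effect of f on u. So C is a unit. *)
Lemma weight_centralizer chi e Q : weight_fun chi e Q ->
  exists2 c : K, c != 0 & forall v, Q (f v) = c * Q v.
Proof.
move=> wQ; have [rQ Qg Qs [v0 _ Q0]] := wQ.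
have [g v|C CE] := semi_invariant wQ (reg_comp rf rQ); first by rewrite fC Qg.
have [g v|Ci CiE] := semi_invariant wQ (reg_comp rfi rQ); first by rewrite fiC Qg.
have [B _ BE] := inv_u_centralizer.
have : C * (Ci \Po B) = 1.
  apply: poly_eq_on_units => u; rewrite hornerC hornerM horner_comp.
  have Qu : Q (slice u) != 0 by rewrite Qs expfz_neq0 ?(valP u).
  apply: (mulfI Qu); rewrite mulrA -slice_u -CE -BE -CiE fK mulr1.
  by [].
move=> /(congr1 (fun p : {poly K} => p \is a GRing.unit)); rewrite unitr1.
rewrite unitrM => /andP[]; rewrite poly_unitE => /andP[/size_poly1P[c c0 cE] _] _.
by exists c => // v; rewrite CE cE hornerC mulrC.
Qed.

(** At the points with y = 0 the equation says that z^b = -1. Since f preserves these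
    points, they give the relation s^b = 1, and for n = 0 they show that f maps
    the roots of z^b = -1 to themselves. *)
Lemma centralizer_diagonal : (0 < k)%N -> (n = 0%N -> 2 <= b ord0)%N ->
  exists t s o, [/\ forall v j, py (f v) j = t j * py v j,
    forall v j, pz (f v) j = s j * pz v j, forall v, pw (f v) = o * pw v
    & mon b s = 1] /\ [/\ forall j, t j != 0 :> K, forall j, s j != 0 :> K & o != 0 :> K].
Proof.
move=> k0 b2.
have ht j : exists c : K, c != 0 /\ forall v, py (f v) j = c * py v j.
  by have [c ? ?] := weight_centralizer (weight_py j); exists c.
have [t tE] := fin_all_exists ht.
have [o o0 oE] := weight_centralizer weight_pw.
have y0_pt z : mon b z = -1 -> exists2 v : point V, pz v =1 z & mon b (pz (f v)) = -1.
  move=> zb; have e : 0 * mon a (fun=> 0) = mon b z + 1 by rewrite zb addNr mul0r.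
  exists (mkpt 1 e) => [j|]; first by rewrite mkptE.
  apply/eqP; rewrite -addr_eq0 -equation (mon0 (a_gt0 (Ordinal k0))) ?mulr0 //.
  by rewrite (tE _).2 mkptE mulr0.
suff [s s0 sE] : exists2 s : 'I_n.+1 -> K, forall j, s j != 0 &
    forall v j, pz (f v) j = s j * pz v j.
  exists t, s, o; split; split=> //; try by [move=> v j; case: (tE j) | move=> j; case: (tE j)].
  have [z0 z0b] : exists z0 : K, z0 ^+ b ord0 = -1.
    exact: root_ex.
  have [|v vz vb] := y0_pt (fun j => if j == ord0 then z0 else 1).
    rewrite /mon (bigD1 ord0) //= z0b big1 ?mulr1 // => i /negbTE->.
    by rewrite expr1n.
  move: vb; rewrite (eq_mon b (sE v)) monM (eq_mon b vz).
  rewrite [X in _ * X](_ : _ = -1) ?mulrN1 => [/oppr_inj //|].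
  rewrite /mon (bigD1 ord0) //= z0b big1 ?mulr1 // => i /negbTE->.
  by rewrite expr1n.
have [n0|n0] := posnP n; last first.
  have hs j : exists c : K, c != 0 /\ forall v, pz (f v) j = c * pz v j.
    by have [c ? ?] := weight_centralizer (weight_pz j n0); exists c.
  have [s sE] := fin_all_exists hs.
  by exists s => [j|v j]; [exact: (sE j).1 | exact: (sE j).2].
have ord1n (j : 'I_n.+1) : j = ord0 by apply/val_inj; case: j => -[] // j; rewrite n0.
have sum1 (R : nmodType) (F : 'I_n.+1 -> R) : \sum_j F j = F ord0.
  by rewrite (bigD1 ord0) //= big1 ?addr0 // => i; rewrite (ord1n i).
have prod1 (F : 'I_n.+1 -> K) : \prod_j F j = F ord0.
  by rewrite (bigD1 ord0) //= big1 ?mulr1 // => i; rewrite (ord1n i).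
(* For n = 0 the matrix M is 1 by 1, so beta = 1 and u = z_0. *)
have beta1 : beta ord0 = 1%N.
  have := congr1 (fun B : 'M[int]_n.+1 => B ord0 ord0) MM'.
  rewrite !mxE sum1 M0 => /(congr1 absz); rewrite abszM /= => /eqP.
  by rewrite muln_eq1 => /andP[/eqP].
have uE v : inv_u v = pz v ord0 by rewrite /inv_u /mon prod1 beta1.
have [B sB BE] := inv_u_centralizer.
have B0 : B.[0] = 0.
  apply: (affine_fix_roots charK (b2 n0) sB) => z zb.
  have [|v vz] := y0_pt (fun=> z); first by rewrite /mon prod1.
  by rewrite /mon prod1 -uE BE uE vz.
have BX : B = B`_1 *: 'X.
  apply/polyP => i; rewrite coefZ coefX.
  case: i => [|[|i]] /=; rewrite ?mulr0 ?mulr1 // -?horner_coef0 //.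
  by rewrite nth_default // sB.
exists (fun=> B`_1) => [j|v j]; last first.
  by rewrite (ord1n j) -!uE BE BX hornerZ hornerX !coefZ !coefX mulr1.
by apply/eqP => B10; move: sB; rewrite BX B10 scale0r size_poly0.
Qed.

End Centralizer.

(** The effect on x follows from the equation, on generic points. *)
Lemma diagonal_torus (f : aut V) t s o :
  (forall v j, py (f v) j = t j * py v j) -> (forall v j, pz (f v) j = s j * pz v j) ->
  (forall v, pw (f v) = o * pw v) -> (forall j, t j != 0) -> (forall j, s j != 0) ->
  o != 0 -> mon beta s = 1 -> torus f.
Proof.
move=> ft fs fo t0 s0 o0 s1; have [g [gt gs go]] := torus_point t0 s0 o0 s1.
exists g => v; apply: (regmap_density charK a_gt0 b_gt0 v (aut_regular f) (act_regular g)).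
move=> {}v [y0 z0 w0].
have ey : py (f v) =1 py (act g v) by move=> j; rewrite actE ft gt.
have ez : pz (f v) =1 pz (act g v) by move=> j; rewrite actE fs gs.
apply: point_ext => //; last by rewrite actE fo go.
have ma : mon a (py (f v)) != 0 by apply: mon_neq0 => j; rewrite ft mulf_neq0.
by apply: (mulIf ma); rewrite [in RHS](eq_mon a ey) !equation (eq_mon b ez).
Qed.

(** An element f of a larger torus T' is the d-th power of some p in T', and p
    commutes with the whole torus. So p is diagonal with s^b = 1, and the factors s^d of f
    satisfy (s^d)^beta = s^b = 1. *)
Lemma torus_maximal : (0 < k)%N -> (n = 0%N -> 2 <= b ord0)%N ->
  is_maximal_torus D torus.
Proof.
move=> k0 b2; split; first exact: torusP.
move=> d' T' [G' [rho' [[rhoM _ _ T'E] [phi [psi [phiK psiK _ _ phiM]]]]]] TT' f.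
have psiM g h : psi (Gm_mul g h) = ag_mul (psi g) (psi h).
  by rewrite -[RHS]phiK phiM !psiK.
have commG x y : ag_mul x y = ag_mul y x :> point G'.
  by rewrite -[LHS]phiK phiM /= Gm_mulC -[RHS]phiK phiM.
move=> /T'E[x fx].
have hr i : exists r : K, r ^+ d = gc (phi x) i by apply: root_ex; apply: d_gt0.
have [r rE] := fin_all_exists hr.
have [i|h hE] := @mkGm K d' r.
  have := gc_neq0 (phi x) i; rewrite -rE; apply: contra_neq => ->.
  by rewrite expr0n eqn0Ngt d_gt0.
have hpow m : exists hm, gc hm =1 (fun i => r i ^+ m) /\
    forall v, rho' (psi hm) v = iter m (rho' (psi h)) v.
  elim: m => [|m [hm [hmE IH]]].
    exists (Gm_one K d'); split=> [i|v]; first by rewrite gc1.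
    have e1 : ag_mul (psi (Gm_one K d')) (psi (Gm_one K d')) = psi (Gm_one K d').
      by rewrite -psiM; congr psi; apply: Gm_ext => i; rewrite gcM gc1 mulr1.
    have := rhoM (psi (Gm_one K d')) (psi (Gm_one K d')) v; rewrite e1 /=.
    by move=> /(congr1 (aut_ifun (rho' (psi (Gm_one K d'))))); rewrite !aut_funK => {2}->.
  exists (Gm_mul h hm); split=> [i|v]; first by rewrite gcM hmE hE exprS.
  by rewrite psiM rhoM /= IH.
have [hd [hdE hdI]] := hpow d.
have fE v : f v = iter d (rho' (psi h)) v.
  rewrite fx -hdI; congr (rho' _ v); rewrite -[LHS]phiK; congr psi.
  by apply: Gm_ext => i; rewrite hdE rE.
pose p := rho' (psi h).
have pC g v : p (act g v) = act g (p v).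
  have /TT'/T'E[y rhoy] : torus (rho g) by exists g.
  have yE : act g =1 rho' y by move=> u; apply: rhoy.
  by rewrite !yE -[LHS](rhoM (psi h) y v) commG rhoM.
have piC g v : aut_ifun p (act g v) = act g (aut_ifun p v).
  by apply: (can_inj (aut_funK p)); rewrite pC !aut_ifunK.
have [t [s [o [[pt ps po s1] [t0 s0 o0]]]]] := centralizer_diagonal (aut_regular p)
  (aut_iregular p) (aut_funK p) (aut_ifunK p) pC piC k0 b2.
apply: (@diagonal_torus f (fun j => t j ^+ d) (fun j => s j ^+ d) (o ^+ d)).
- move=> v j; rewrite fE; elim: (d) => [|m IH]; first by rewrite mul1r.
  by rewrite iterS pt IH exprS mulrA.
- move=> v j; rewrite fE; elim: (d) => [|m IH]; first by rewrite mul1r.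
  by rewrite iterS ps IH exprS mulrA.
- move=> v; rewrite fE; elim: (d) => [|m IH]; first by rewrite mul1r.
  by rewrite iterS po IH exprS mulrA.
- by move=> j; rewrite expf_neq0.
- by move=> j; rewrite expf_neq0.
- by rewrite expf_neq0.
- rewrite -s1 mon_b -prodrXl; apply: eq_bigr => j _.
  by rewrite -!exprM mulnC.
Qed.

Lemma iter_act g m v :
  [/\ px (iter m (act g) v) = mon a (fun j => (tpart g j)^-1) ^+ m * px v,
     forall j, py (iter m (act g) v) j = tpart g j ^+ m * py v j,
     forall j, pz (iter m (act g) v) j = spart g j ^+ m * pz v j
   & pw (iter m (act g) v) = opart g ^+ m * pw v].
Proof.
elim: m => [|m [IHx IHy IHz IHw]] /=; first by split=> *; rewrite mul1r.
by split=> [|j|j|]; rewrite !actE ?IHx ?IHy ?IHz ?IHw exprS mulrA.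
Qed.

Lemma iter_act_id g m : iter m (act g) =1 id <->
  [/\ forall j, tpart g j ^+ m = 1, forall j, spart g j ^+ m = 1
    & opart g ^+ m = 1].
Proof.
split=> [gm|[t1 s1 o1] v].
  have [_ Hy Hz Hw] := iter_act g m (mkpt 1 ones_eqn); rewrite gm in Hy Hz Hw.
  split=> [j|j|]; first by have := Hy j; rewrite mkptE mulr1.
    by have := Hz j; rewrite mkptE mulr1.
  by move: Hw; rewrite mkptE mulr1.
have [Hx Hy Hz Hw] := iter_act g m v.
apply: point_ext => [|j|j|]; rewrite ?Hx ?Hy ?Hz ?Hw ?t1 ?s1 ?o1 ?mul1r //.
rewrite -[RHS]mul1r -prodrXl; congr (_ * _); rewrite /= big1 // => j _.
by rewrite exprAC exprVn t1 invr1 expr1n.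
Qed.

Lemma act_fix g v : act g v = v <->
  [/\ mon a (fun j => (tpart g j)^-1) * px v = px v,
     forall j, tpart g j * py v j = py v j,
     forall j, spart g j * pz v j = pz v j & opart g * pw v = pw v].
Proof.
split=> [E|[ex ey ez ew]].
  by split=> [|j|j|]; rewrite -?act_px -?act_py -?act_pz -?act_pw E.
by apply: point_ext => [|j|j|]; rewrite actE.
Qed.

Lemma two_exp_neq1 m : (0 < m)%N -> (2%:R : K) ^+ m != 1.
Proof.
move=> m0; have := natK_neq0 charK (_ : 0 < 2 ^ m - 1)%N.
rewrite natrB ?expn_gt0 // natrX subr_eq0; apply.
by rewrite subn_gt0 -{1}(expn0 2) ltn_exp2l.
Qed.

Lemma two_neq0 : 2%:R != 0 :> K. Proof. exact: natK_neq0. Qed.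

Lemma mul_fix (x y : K) : x * y = y -> y != 0 -> x = 1.
Proof. by move=> E y0; apply: (mulIf y0); rewrite mul1r. Qed.

Section FiniteStabilizer.
Variables (v : point V) (m : nat).
Hypothesis m_gt0 : (0 < m)%N.
Hypothesis stab_killed : forall g, act g v = v -> iter m (act g) =1 id.

(** Diagonal maps fixing v, seen through their factors. In the next three lemmas,
    as soon as too many coordinates of v vanish there is an explicit one-parameter
    group of such maps, and its element of parameter 2 contradicts the finiteness of the
    exponent m, because 2 has infinite order in K. *)
Lemma fixing_parts_killed t s o : (forall j, t j != 0) -> (forall j, s j != 0) -> o != 0 ->
  mon beta s = 1 -> mon a (fun j => (t j)^-1) * px v = px v ->
  (forall j, t j * py v j = py v j) -> (forall j, s j * pz v j = pz v j) ->
  o * pw v = pw v ->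
  [/\ forall j, t j ^+ m = 1 :> K, forall j, s j ^+ m = 1 :> K & o ^+ m = 1 :> K].
Proof.
move=> t0 s0 o0 s1 ex ey ez ew; have [g [gt gs go]] := torus_point t0 s0 o0 s1.
have /stab_killed/iter_act_id : act g v = v.
  apply/act_fix; split=> [|j|j|]; rewrite ?gt ?gs ?go //.
  by rewrite (eq_mon a (y' := fun j => (t j)^-1)) // => j; rewrite gt.
by case=> ht hs ho; split=> [j|j|]; rewrite -?gt -?gs -?go.
Qed.

Lemma finite_stabilizer_opart g : act g v = v -> opart g = 1.
Proof.
move=> /act_fix[_ _ _ ew]; apply: (mul_fix ew); apply/eqP => w0.
have [||||||||_ _ /eqP] := @fixing_parts_killed (fun=> 1) (fun=> 1) 2%:R.
- by move=> _; apply: oner_neq0.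
- by move=> _; apply: oner_neq0.
- exact: two_neq0.
- by rewrite mon1.
- by rewrite (eq_mon a (y' := fun=> 1)) ?mon1 ?mul1r // => j; rewrite invr1.
- by move=> j; rewrite mul1r.
- by move=> j; rewrite mul1r.
- by rewrite w0 mulr0.
by rewrite (negbTE (two_exp_neq1 m_gt0)).
Qed.

Lemma finite_stabilizer_tpart g N j : (forall j, a j = N) -> act g v = v ->
  tpart g j ^+ N = 1.
Proof.
move=> aN /act_fix[ex ey _ _].
have [y0|/(mul_fix (ey j))->] := eqVneq (py v j) 0; last by rewrite expr1n.
have monN (t : 'I_k -> K) : mon a t = (\prod_j t j) ^+ N.
  by rewrite -prodrXl; apply: eq_bigr => i _; rewrite aN.
have [x0|x0] := eqVneq (px v) 0.
  have [||||||||tm _ _] := @fixing_parts_killed (fun i => if i == j then 2%:R else 1) (fun=> 1) 1.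
  - by move=> i; case: (i =P j) => _; [apply: two_neq0 | apply: oner_neq0].
  - by move=> _; apply: oner_neq0.
  - exact: oner_neq0.
  - by rewrite mon1.
  - by rewrite x0 mulr0.
  - by move=> i; case: eqP => [->|_]; rewrite ?y0 ?mulr0 // mul1r.
  - by move=> i; rewrite mul1r.
  - by rewrite mul1r.
  by have := tm j; rewrite eqxx => /eqP; rewrite (negbTE (two_exp_neq1 m_gt0)).
(* If y_i = y_j = 0, the factors 2 and 1/2 leave x unchanged. *)
have others i : i != j -> tpart g i = 1.
  move=> ij; apply: (mul_fix (ey i)); apply/eqP => yi0.
  have [||||||||tm _ _] := @fixing_parts_killed
    (fun l => if l == j then 2%:R else if l == i then 2%:R^-1 else 1) (fun=> 1) 1.
  - move=> l; case: (l =P j) => _; first exact: two_neq0.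
    by case: (l =P i) => _; rewrite ?invr_eq0 ?two_neq0 ?oner_neq0.
  - by move=> _; apply: oner_neq0.
  - exact: oner_neq0.
  - by rewrite mon1.
  - rewrite monN (bigD1 j) //= (bigD1 i) //= !eqxx (negbTE ij) big1 => [|l].
      by rewrite mulr1 invrK mulVf ?two_neq0 // expr1n mul1r.
    by move=> /andP[/negbTE-> /negbTE->]; rewrite invr1.
  - move=> l; case: eqP => [->|_]; first by rewrite y0 !mulr0.
    by case: eqP => [->|_]; rewrite ?yi0 ?mulr0 // mul1r.
  - by move=> l; rewrite mul1r.
  - by rewrite mul1r.
  by have := tm j; rewrite eqxx => /eqP; rewrite (negbTE (two_exp_neq1 m_gt0)).
have := mul_fix ex x0; rewrite monN (bigD1 j) //= big1 => [|i /others->].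
  by rewrite mulr1 exprVn => /eqP; rewrite invr_eq1 => /eqP.
by rewrite invr1.
Qed.

Lemma finite_stabilizer_spart g j : act g v = v -> spart g j ^+ beta j = 1.
Proof.
move=> /act_fix[_ _ ez _].
have [z0|/(mul_fix (ez j))->] := eqVneq (pz v j) 0; last by rewrite expr1n.
(* If z_i = z_j = 0, the factors 2^beta_i and 2^(-beta_j) satisfy s^beta = 1. *)
have others i : i != j -> spart g i = 1.
  move=> ij; apply: (mul_fix (ez i)); apply/eqP => zi0.
  have [||||||||_ sm _] := @fixing_parts_killed (fun=> 1)
    (fun l => if l == j then 2%:R ^+ beta i else
              if l == i then 2%:R^-1 ^+ beta j else 1) 1.
  - by move=> _; apply: oner_neq0.
  - move=> l; case: (l =P j) => _; first by rewrite expf_neq0 ?two_neq0.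
    by case: (l =P i) => _; rewrite ?expf_neq0 ?invr_eq0 ?two_neq0 ?oner_neq0.
  - exact: oner_neq0.
  - rewrite /mon (bigD1 j) //= (bigD1 i) //= !eqxx (negbTE ij) big1 => [|l].
      by rewrite mulr1 -!exprM mulnC -exprMn mulfV ?two_neq0 // expr1n.
    by move=> /andP[/negbTE-> /negbTE->]; rewrite expr1n.
  - by rewrite (eq_mon a (y' := fun=> 1)) ?mon1 ?mul1r // => l; rewrite invr1.
  - by move=> l; rewrite mul1r.
  - move=> l; case: eqP => [->|_]; first by rewrite z0 !mulr0.
    by case: eqP => [->|_]; rewrite ?zi0 ?mulr0 // mul1r.
  - by rewrite mul1r.
  have := sm j; rewrite eqxx -exprM => /eqP; apply/negP/two_exp_neq1.
  by rewrite muln_gt0 beta_gt0.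
have := mon_spart g; rewrite /mon (bigD1 j) //= big1 ?mulr1 // => i /others->.
by rewrite expr1n.
Qed.

End FiniteStabilizer.

Lemma torus_stabilizer_dvd N L : (forall j, a j = N) -> (N %| L)%N ->
  (forall j, b j %| L)%N -> ~ stabilizer_exponent_ndvd L torus.
Proof.
move=> aN NL bL [v [[m m0 kill] [f [g fg] [fv]]]]; apply.
have {}kill h : act h v = v -> iter m (act h) =1 id.
  by move=> hv; apply: (kill (rho h)) => //; exists h.
have gv : act g v = v by rewrite -[RHS]fv fg.
suff gL : iter L (act g) =1 id.
  by move=> u; rewrite -[RHS]gL; elim: (L) => //= l ->; rewrite fg.
apply/iter_act_id; split=> [j|j|].
- case/dvdnP: NL => c ->; rewrite mulnC exprM.
  by rewrite (finite_stabilizer_tpart m0 kill j aN gv) expr1n.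
- have /dvdnP[c ->] : (beta j %| L)%N by apply: dvdn_trans (bL j); rewrite b_eq dvdn_mull.
  by rewrite mulnC exprM (finite_stabilizer_spart m0 kill j gv) expr1n.
- by rewrite (finite_stabilizer_opart m0 kill gv) expr1n.
Qed.

(** The point has y_j as only zero coordinate, with x = w = 1: its stabilizer
    consists of the factors of y_j that are 2h-th roots of unity. A factor
    zeta with zeta^h = -1 is not killed by any divisor of h. *)
Lemma torus_stabilizer_ndvd j L h : a j = h.*2 -> (L %| h)%N ->
  stabilizer_exponent_ndvd L torus.
Proof.
move=> ajh /dvdnP[c hE].
have h0 : (0 < h)%N by have := a_gt0 j; rewrite ajh double_gt0.
have [zeta zE] := root_ex (-1 : K) h0.
have z0 : zeta != 0.
  by apply: contra_eq_neq zE => ->; rewrite expr0n gtn_eqF // eq_sym oppr_eq0 oner_eq0.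
have [r rE] := root_ex (-1 : K) (b_gt0 ord0).
have r0 : r != 0.
  apply: contra_eq_neq rE => ->.
  by rewrite expr0n gtn_eqF ?b_gt0 // eq_sym oppr_eq0 oner_eq0.
pose y (i : 'I_k) : K := if i == j then 0 else 1.
pose z (i : 'I_n.+1) : K := if i == ord0 then r else 1.
have zb : mon b z = -1.
  rewrite /mon (bigD1 ord0) //= rE big1 ?mulr1 // => i /negbTE ne.
  by rewrite /z ne expr1n.
have e : 1 * mon a y = mon b z + 1.
  by rewrite zb addNr mul1r (mon0 (a_gt0 j)) // /y eqxx.
pose v := mkpt 1 e.
have zn i : pz v i != 0.
  by rewrite mkptE /z; case: (i =P ord0) => _; rewrite ?r0 ?oner_neq0.
exists v; split.
  exists (a j) => // f [g fg] fv.
  have gv : act g v = v by rewrite -[RHS]fv fg.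
  suff gL : iter (a j) (act g) =1 id.
    by move=> u; rewrite -[RHS]gL; elim: (a j) => //= l ->; rewrite fg.
  move/act_fix: gv => [ex ey ez ew].
  have others i : i != j -> tpart g i = 1.
    by move=> ij; apply: (mul_fix (ey i)); rewrite mkptE /y (negbTE ij) oner_neq0.
  have tj : tpart g j ^+ a j = 1.
    have := mul_fix ex; rewrite mkptE => /(_ (oner_neq0 _)).
    rewrite /mon (bigD1 j) //= big1 ?mulr1 => [|i /others->]; last by rewrite invr1 expr1n.
    by rewrite exprVn => /eqP; rewrite invr_eq1 => /eqP.
  apply/iter_act_id; split=> [i|i|].
  - by have [->//|/others->] := eqVneq i j; rewrite expr1n.
  - by rewrite (mul_fix (ez i)) // expr1n.
  - by rewrite (mul_fix ew) ?expr1n // mkptE oner_neq0.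
have [i|i|||g [gt gs go]] := @torus_point (fun i => if i == j then zeta else 1) (fun=> 1) 1.
- by case: (i =P j) => _; rewrite ?oner_neq0.
- exact: oner_neq0.
- exact: oner_neq0.
- by rewrite mon1.
exists (rho g); first by exists g.
split.
  apply/act_fix; split=> [|i|i|]; rewrite ?gs ?go ?mul1r //.
    rewrite mkptE mulr1 /mon (bigD1 j) //= gt eqxx big1 => [|i /negbTE ne].
      by rewrite mulr1 ajh -addnn exprD exprVn zE invrN1 mulrNN mulr1.
    by rewrite gt ne invr1 expr1n.
  by rewrite gt mkptE /y; case: eqP; rewrite ?mulr0 ?mulr1.
move=> /iter_act_id[/(_ j) + _ _]; rewrite gt eqxx => zL.
have /eqP : zeta ^+ h = 1 by rewrite hE mulnC exprM zL expr1n.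
by rewrite zE eq_sym -addr_eq0 (negbTE two_neq0).
Qed.

End Torus.

(** * The dimension of X *)

(** More polynomials than monomials available to them. *)
Lemma mpoly_dependent (K : fieldType) (m B : nat) (I : finType)
    (p : I -> {mpoly K[m]}) :
  (forall i u, u \in msupp (p i) -> forall l, (u l < B)%N) -> (B ^ m < #|I|)%N ->
  exists q : I -> K, (exists i, q i != 0) /\ \sum_i q i *: p i = 0.
Proof.
move=> pB BI; pose J := {ffun 'I_m -> 'I_B}.
pose mn (f : J) : 'X_{1..m} := [multinom (f l : nat) | l < m].
pose M : 'M[K]_(#|I|, #|J|) := \matrix_(i, j) (p (enum_val i))@_(mn (enum_val j)).
have rkM : (\rank M < #|I|)%N.
  by apply: leq_ltn_trans (rank_leq_col M) _; rewrite card_ffun !card_ord.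
have : kermx M != 0 by rewrite kermx_eq0 neq_ltn rkM.
case/rowV0Pn => row /sub_kermxP rowM row0.
exists (fun i => row 0 (enum_rank i)); split.
  case/rV0Pn: row0 => j rj; exists (enum_val j).
  by rewrite enum_valK.
apply/mpolyP => u; rewrite mcoeff0 raddf_sum /=.
have [/forallP uB|] := boolP [forall l, u l < B]%N; last first.
  rewrite negb_forall => /existsP[l ul]; apply: big1 => i _.
  rewrite mcoeffZ [X in _ * X](_ : _ = 0) ?mulr0 //; apply/eqP.
  by rewrite mcoeff_eq0; apply: contra ul => /pB.
pose f : J := [ffun l => Ordinal (uB l)].
have fu : mn f = u by apply/mnmP => l; rewrite mnmE ffunE.
have := congr1 (fun R : 'rV[K]__ => R 0 (enum_rank f)) rowM; rewrite !mxE => E.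
rewrite -[RHS]E (reindex (@enum_val I predT)) /=; last first.
  by apply: onW_bij; apply: enum_val_bij.
by apply: eq_bigr => i _; rewrite mcoeffZ mxE !enum_rankK enum_valK fu.
Qed.

Lemma msize_mul_le (K : fieldType) m (p q : {mpoly K[m]}) d e :
  (msize p <= d.+1)%N -> (msize q <= e.+1)%N -> (msize (p * q) <= (d + e).+1)%N.
Proof.
have [->|p0] := eqVneq p 0; first by rewrite mul0r msize0.
have [->|q0] := eqVneq q 0; first by rewrite mulr0 msize0.
move=> pd qe; rewrite msizeM // -subn1 leq_subLR add1n.
by apply: leq_trans (leq_add pd qe) _; rewrite addSn addnS.

Qed.

Lemma msize_exp_le (K : fieldType) m (p : {mpoly K[m]}) d j :
  (msize p <= d.+1)%N -> (msize (p ^+ j) <= (j * d).+1)%N.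
Proof.
move=> pd; elim: j => [|j IH]; first by rewrite expr0 msize1.
by rewrite exprS mulSn; apply: msize_mul_le.
Qed.

Section Dimension.
Variables (K : closedFieldType) (k n : nat).
Variables (a : 'I_k -> nat) (b : 'I_n.+1 -> nat).
Hypotheses (charK : [pchar K] =i pred0).
Hypotheses (a_gt0 : forall j, (0 < a j)%N) (b_gt0 : forall j, (0 < b j)%N).
Local Notation V := (variety K a b).
Local Notation m := (k.+1 + n.+1)%N.

(** The coordinates w, y, z, which parametrize the part of V where y has no zero. *)
Definition param (i : 'I_m) (v : point V) : K :=
  match split i with
  | inl j => oapp (py v) (pw v) (unlift ord0 j)
  | inr j => pz v j
  end.

Lemma param_w v : param (lshift n.+1 ord0) v = pw v.
Proof. by rewrite /param -[lshift _ _]/(unsplit (inl ord0)) unsplitK unlift_none. Qed.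
Lemma param_y v j : param (lshift n.+1 (lift ord0 j)) v = py v j.
Proof. by rewrite /param -[lshift _ _]/(unsplit (inl _)) unsplitK liftK. Qed.
Lemma param_z v j : param (rshift k.+1 j) v = pz v j.
Proof. by rewrite /param -[rshift _ _]/(unsplit (inr _)) unsplitK. Qed.

Lemma param_regular i : regular_fun (param i).
Proof.
rewrite -(splitK i); case: (split i) => [j|j] /=; last first.
  by apply: (@reg_ext _ V (fun v => pz v j)) => [v|]; [rewrite param_z | apply: reg_pz].
case: (unliftP ord0 j) => [j'|] ->.
  by apply: (@reg_ext _ V (fun v => py v j')) => [v|]; [rewrite param_y | apply: reg_py].
by apply: (@reg_ext _ V (@pw K k n a b)) => [v|]; [rewrite param_w | apply: reg_pw].
Qed.

Lemma param_indep : alg_indep param.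
Proof.
move=> P P0; apply: mpoly_vanish_eq0 => u u0.
pose y j := u (lshift n.+1 (lift ord0 j)); pose z j := u (rshift k.+1 j).
have e : (mon b z + 1) / mon a y * mon a y = mon b z + 1.
  by rewrite divfK //; apply: mon_neq0 => j; apply: u0.
rewrite -(P0 (mkpt (u (lshift n.+1 ord0)) e)); apply: meval_eq => i.
rewrite -(splitK i); case: (split i) => [j|j] /=; last by rewrite param_z mkptE.
by case: (unliftP ord0 j) => [j'|] ->; rewrite ?param_y ?param_w mkptE.
Qed.

Definition polM : {mpoly K[m]} := mon a (fun j => 'X_(lshift n.+1 (lift ord0 j))).

Lemma meval_mon l (c : 'I_l -> nat) (y : 'I_l -> {mpoly K[m]}) (u : 'I_m -> K) :
  (mon c y).@[u] = mon c (fun j => (y j).@[u]).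
Proof. by rewrite rmorph_prod; apply: eq_bigr => j _; rewrite rmorphXn. Qed.

Lemma polME v : polM.@[param^~ v] = mon a (py v).
Proof. by rewrite meval_mon; apply: eq_mon => j; rewrite mevalXU param_y. Qed.

Lemma clear_denominator F : regular_fun F -> exists e (P : {mpoly K[m]}),
  forall v, mon a (py v) ^+ e * F v = P.@[param^~ v].
Proof.
pose Q (h : point V -> K) := exists e (P : {mpoly K[m]}),
  forall v, mon a (py v) ^+ e * h v = P.@[param^~ v].
apply: (@meval_variety K k n a b (point V) Q id).
- by move=> f h fh [e [P E]]; exists e, P => v; rewrite -fh.
- by move=> c; exists 0%N, c%:MP => v; rewrite mul1r mevalC.
- move=> f h [e [P E]] [e' [P' E']]; exists (e + e')%N, (polM ^+ e' * P + polM ^+ e * P').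
  move=> v; rewrite mevalD !mevalM !rmorphXn /= polME -E -E' exprD.
  set M := mon _ _; ring.
- move=> f h [e [P E]] [e' [P' E']]; exists (e + e')%N, (P * P').
  by move=> v; rewrite mevalM -E -E' exprD mulrACA.
- exists 1%N, (mon b (fun j => 'X_(rshift k.+1 j)) + 1) => v.
  rewrite mevalD meval1 meval_mon expr1 mulrC equation; congr (_ + 1).
  by apply: eq_mon => j; rewrite mevalXU param_z.
- by move=> j; exists 0%N, 'X_(lshift n.+1 (lift ord0 j)) => v; rewrite mul1r mevalXU param_y.
- by move=> j; exists 0%N, 'X_(rshift k.+1 j) => v; rewrite mul1r mevalXU param_z.
- by exists 0%N, 'X_(lshift n.+1 ord0) => v; rewrite mul1r mevalXU param_w.
Qed.

(** After multiplication by a common power of y^a, the F i become polynomials in the m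
    parameters. The monomials of degree less than D in each F i number D^r, and after
    multiplication by a further power of y^a they are polynomials in the m parameters
    whose exponents are less than c D, with c independent of D. If r > m and D is large,
    then D^r > (c D)^m and a linear relation between the monomials appears. *)
Lemma indep_bound r (F : 'I_r -> point V -> K) :
  (forall i, regular_fun (F i)) -> alg_indep F -> (r <= m)%N.
Proof.
move=> rF iF; rewrite leqNgt; apply/negP => mr.
have [e0 e0E] := fin_all_exists (fun i => clear_denominator (rF i)).
have [P0 P0E] := fin_all_exists e0E.
pose E := (\sum_i e0 i)%N.
pose P i := polM ^+ (E - e0 i) * P0 i.
have PE i v : mon a (py v) ^+ E * F i v = (P i).@[param^~ v].
  rewrite mevalM rmorphXn /= polME -P0E mulrA -exprD subnK //.
  by rewrite /E (bigD1 i) //= leq_addr.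
pose dl := (msize (polM ^+ E) + \sum_i msize (P i))%N.
have szP i : (msize (P i) <= dl.+1)%N.
  by rewrite /dl (bigD1 i) //= addnCA -addnS leq_addr.
have szM : (msize (polM ^+ E) <= dl.+1)%N by rewrite /dl -addnS leq_addr.
pose c := (r * dl).+1; pose D := (c ^ m).+1.
pose I := {ffun 'I_r -> 'I_D}.
pose sm (d : I) := (\sum_i d i)%N.
have smD d : (sm d <= r * D)%N.
  rewrite -[X in (X * _)%N]card_ord -sum_nat_const; apply: leq_sum => i _.
  exact: ltnW.
pose A (d : I) := (\prod_i P i ^+ d i) * (polM ^+ E) ^+ (r * D - sm d).
have AE d v : (A d).@[param^~ v] =
    mon a (py v) ^+ (E * (r * D)) * \prod_i F i v ^+ d i.
  rewrite mevalM rmorph_prod !rmorphXn /= polME.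
  under eq_bigr => i _ do rewrite rmorphXn /= -PE exprMn.
  rewrite big_split /= mulrAC; congr (_ * _).
  by rewrite prodrXr -/(sm d) -exprD subnKC // [in RHS]exprM.
have szA d : (msize (A d) <= (r * D * dl).+1)%N.
  have : (msize (\prod_i P i ^+ d i) <= (sm d * dl).+1)%N.
    rewrite /sm; elim/big_rec2: _ => [|i x y _ IH]; first by rewrite msize1.
    rewrite mulnDl; apply: msize_mul_le => //.
    exact: msize_exp_le.
  move=> /msize_mul_le /(_ (msize_exp_le (r * D - sm d) szM)) /leq_trans -> //.
  by rewrite -mulnDl subnKC.
have [||q [[d0 qd0] qA]] := @mpoly_dependent K m (c * D) I A.
- move=> d u /msize_mdeg_lt ud l; apply: leq_ltn_trans (_ : mdeg u < _)%N.
    by rewrite mdegE (bigD1 l) //= leq_addr.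
  apply: leq_trans ud (leq_trans (szA d) _).
  by rewrite /c mulSn mulnAC addnC -addn1 leq_add2l.
- rewrite card_ffun !card_ord expnMn.
  apply: leq_trans (_ : D ^ m.+1 <= _)%N; last by rewrite leq_exp2l // /D ltnS expn_gt0.
  by rewrite expnS ltn_pmul2r ?expn_gt0 // /D.
pose mn (d : I) : 'X_{1..r} := [multinom (d i : nat) | i < r].
have mn_inj : injective mn.
  move=> d d' dd; apply/ffunP => i; apply: val_inj.
  by have := congr1 (fun u : 'X_{1..r} => u i) dd; rewrite !mnmE.
pose Q : {mpoly K[r]} := \sum_d q d *: 'X_[mn d].
have QF v : Q.@[fun i => F i v] = \sum_d q d * \prod_i F i v ^+ d i.
  rewrite raddf_sum /=; apply: eq_bigr => d _.
  by rewrite mevalZ mevalX; congr (_ * _); apply: eq_bigr => i _; rewrite mnmE.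
have Q0 : Q = 0.
  apply: iF => v; apply: (density charK a_gt0 b_gt0 (F := fun v => Q.@[fun i => F i v])).
    apply: (@meval_closed K (point V) (@regular_fun K V) r F) => //.
    - exact: reg_ext.
    - exact: reg_const.
    - exact: reg_add.
    - exact: reg_mul.
  move=> {}v [y0 _ _]; apply: (mulfI (expf_neq0 (E * (r * D)) (mon_neq0 a y0))).
  rewrite mulr0 QF big_distrr /=.
  have := congr1 (meval (param^~ v)) qA; rewrite meval0 raddf_sum /= => {2}<-.
  by apply: eq_bigr => d _; rewrite mevalZ AE mulrCA.
move/eqP: qd0; apply; have := congr1 (mcoeff (mn d0)) Q0.
rewrite mcoeff0 raddf_sum /= (bigD1 d0) //= mcoeffZ mcoeffX eqxx mulr1.
rewrite big1 ?addr0 // => d ne; rewrite mcoeffZ mcoeffX (inj_eq mn_inj).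
by rewrite (negbTE ne) mulr0.
Qed.

Lemma variety_dim : has_dim V m.
Proof.
split; last exact: indep_bound.
by exists param; split; [apply: param_regular | apply: param_indep].
Qed.

End Dimension.

(** * Non-conjugate maximal tori *)

Theorem corollary5p4 (K : closedFieldType) (charK : [pchar K] =i pred0)
    (n1 n2 : nat) (hn1 : (2 <= n1)%N) (hn2 : (1 <= n2)%N)
    (l1 : 'I_n1 -> nat) (l2 : 'I_n2 -> nat)
    (l1_gt0 : forall j, (0 < l1 j)%N) (l2_gt0 : forall j, (0 < l2 j)%N)
    (l11 : forall j : 'I_n1, nat_of_ord j = 0%N -> l1 j = 1%N)
    (l21 : n2 = 1%N -> forall j, (2 <= l2 j)%N) :
  let X := affprod (trinomial_hypersurface K l1 l2) (affine_line K) in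
  has_dim X (n1 + n2) /\
  exists T : nat -> aut X -> Prop,
    (forall i, is_maximal_torus (n1 + n2 - 1) (T i)) /\
    (forall i j, i <> j -> ~ conjugate (T i) (T j)).
Proof.
case: n1 => [//|k] in hn1 l1 l1_gt0 l11 *.
case: n2 => [//|n] in hn2 l2 l2_gt0 l21 *.
have k_gt0 : (0 < k)%N by [].
pose a (j : 'I_k) := l1 (lift ord0 j); pose b := l2.
have a_gt0 j : (0 < a j)%N by apply: l1_gt0.
have b2 : (n = 0 -> 2 <= b ord0)%N by move=> n0; apply: l21; rewrite n0.
have -> : trinomial_hypersurface K l1 l2 = trinomial_hypersurface K (cons1 a) b.
  congr (AffSet [:: _ - _]); apply: eq_bigr => j _; rewrite /cons1.
  by case: unliftP => [i|] -> //; rewrite l11.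
split; first exact: variety_dim.
rewrite (_ : k.+1 + n.+1 - 1 = k + n.+1)%N; last by rewrite addSn subn1.
have [d [beta [M [M' [MM' M'M M0 b_eq]]]]] := primitive_row l2_gt0.
pose B := (\prod_j b j)%N; pose A := (\sum_j a j)%N.
have B0 : (0 < B)%N by apply: prodn_gt0.
have A0 : (0 < A)%N.
  by rewrite /A (bigD1 (Ordinal k_gt0)) //= ltn_addr.
(* B is a multiple of every b_j, and A bounds the original exponents of y. If i < j,
   then N i * B divides N j / 2, so that the i-th and the j-th torus are told apart by
   L = N i * B. *)
pose N i := ((B.*2) ^ i * A)%N.
have N0 i : (0 < N i)%N by rewrite muln_gt0 expn_gt0 double_gt0 B0.
have aN i j : (a j <= N i)%N.
  apply: leq_trans (_ : A <= _)%N; first by rewrite /A (bigD1 j) //= leq_addr.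
  by rewrite leq_pmull // expn_gt0 double_gt0 B0.
have iso i : isomorphism (variety K a b) (variety K (fun _ : 'I_k => N i) b).
  by apply: (@danielewski _ charK _ _ a (fun=> N i) b (N i)) => // j; rewrite leq_pmulr.
pose phi i := projT1 (iso i); pose psi i := sval (projT2 (iso i)).
have phiK i : cancel (phi i) (psi i) by case: (svalP (projT2 (iso i))).
have psiK i : cancel (psi i) (phi i) by case: (svalP (projT2 (iso i))).
have rphi i : regular_map (phi i) by case: (svalP (projT2 (iso i))).
have rpsi i : regular_map (psi i) by case: (svalP (projT2 (iso i))).
pose S i := @torus K k n (fun=> N i) b d beta M M' MM' M0 b_eq.
have maxS i : is_maximal_torus (k + n.+1) (@S i) by apply: torus_maximal.
exists (fun i => pull (phiK i) (psiK i) (rphi i) (rpsi i) (@S i)).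
split=> [i|]; first exact: pull_maximal_torus.
have notL i : ~ stabilizer_exponent_ndvd (N i * B) (@S i).
  apply: torus_stabilizer_dvd => // [|j]; first exact: dvdn_mulr.
  by rewrite /B (bigD1 j) //= dvdn_mull // dvdn_mulr.
have isL i j : (i < j)%N -> stabilizer_exponent_ndvd (N i * B) (@S j).
  case: j => // j; rewrite ltnS => ij.
  apply: (@torus_stabilizer_ndvd _ _ _ _ _ _ _ _ _ _ _ _ _ _ _ _ (Ordinal k_gt0) _ (N j * B)) => //.
    by rewrite /N expnS -!mul2n; lia.
  by rewrite dvdn_mul // /N dvdn_mul // dvdn_exp2l.
move=> i j ij TT; case: (ltngtP i j) ij => // ij _.
  apply: (notL i); apply/(stabilizer_exponent_pull (phiK i) (psiK i) (rphi i) (rpsi i) _ (maxS i).1).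
  apply/(stabilizer_exponent_conjugate _ TT).
  by apply/(stabilizer_exponent_pull (phiK j) (psiK j) (rphi j) (rpsi j) _ (maxS j).1); apply: isL.
apply: (notL j); apply/(stabilizer_exponent_pull (phiK j) (psiK j) (rphi j) (rpsi j) _ (maxS j).1).
apply/(stabilizer_exponent_conjugate _ TT).
by apply/(stabilizer_exponent_pull (phiK i) (psiK i) (rphi i) (rpsi i) _ (maxS i).1); apply: isL.
Qed.
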